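(* Let $n\ge1$. For any $k,l\in\{1,\dots,n+1\}$ and any two twisted adapted classes $[\mathbf i_0]$ and $[\mathbf i_0']$ of type $A_{2n+1}$, the folded distance polynomials coincide: $$\widehat D^{[\mathbf i_0]}_{k,l}(z)=\widehat D^{[\mathbf i_0']}_{k,l}(z).$$
   Context: Let $I=\{1,\dots,2n+1\}$, $W$ the Weyl group of type $A_{2n+1}$ with simple reflections $s_i$, simple roots $\alpha_i$, positive roots $\Phi^+$, longest element $w_0$ of length $N$. Reduced words of $w_0$ are commutation equivalent if related by swapping neighbouring letters $i,j$ with $|i-j|\ge2$; $[\mathbf i]$ is the commutation class. $i$ is a sink (resp. source) of $[\mathbf i]$ if some word in the class starts (resp. ends) with $i$. With $i^*=2n+2-i$, reflection functors: if $i$ is a sink and $i\,i_2\cdots i_N\in[\mathbf i]$, $[\mathbf i]r_i=[i_2\cdots i_N\,i^*]$; if $i$ is a source and $i_1\cdots i_{N-1}i\in[\mathbf i]$, $r_i[\mathbf i]=[i^*i_1\cdots i_{N-1}]$; otherwise unchanged. Put $i^\vee=2n+2-i$; $(\cdot)^{k\vee}$ applies $\vee$ letterwise $k$ times. A class is twisted adapted if obtained by a sequence of reflection functors from the class of the reduced word $\prod_{k=0}^{2n}(1\,2\cdots n{+}1)^{k\vee}$ of $w_0$. For a reduced word $\mathbf j=i_1\cdots i_N$ put $\beta^{\mathbf j}_k=s_{i_1}\cdots s_{i_{k-1}}(\alpha_{i_k})$. Write $\alpha\prec_{[\mathbf i_0]}\beta$ if $\alpha$ precedes $\beta$ in $\beta^{\mathbf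 j}_1,\dots,\beta^{\mathbf j}_N$ for every $\mathbf j\in[\mathbf i_0]$. The quiver $\Upsilon_{[\mathbf i_0]}$ has vertex set $\Phi^+$; $\beta^{\mathbf i_0}_k$ has residue $i_k$; there is an arrow $\beta_k\to\beta_j$ iff $|i_k-i_j|=1$, $j=\max\{j'<k:i_{j'}=i_j\}$, $k=\min\{k'>j:i_{k'}=i_k\}$. Coordinates. Let $P$ delete letters $n+1$ and replace each letter $j\ge n+2$ by $j-1$. There is a unique Dynkin quiver $Q$ of type $A_{2n}$ such that $P(\mathbf i_0)$ is a reduced word of the longest element of type $A_{2n}$ adapted to $Q$ (each $k$-th letter is a sink of the quiver obtained from $Q$ by reversing successively all arrows at the preceding letters). Fix $\xi$ on vertices of $Q$ with $\xi(j)=\xi(i)+1$ for each arrow $i\to j$. The $k$-th root of residue $i\le n$ (in the order of $\mathbf i_0$) has coordinate $\Omega_{[\mathbf i_0]}=(i,\xi(i)-2(k-1))$; the $k$-th root of residue $i\ge n+2$ has coordinate $(i,\xi(i-1)-2(k-1))$; a root of residue $n+1$ has coordinate $(n+1,p+\frac12)$ if it receives an arrow from a vertex $(j,p)$, and $(n+1,p-\frac12)$ if it has an arrow to a vertex $(j,p)$. If $\Omega_{[\mathbf i_0]}(\beta)=(i,\frac p2)$, the folded coordinate is $\widehat\Omega_{[\mathbf i_0]}(\beta)=(\bar i,p)$ with $\bar i=\min(i,2n+2-i)\in\bar I=\{1,\dots,n+1\}$. Distance. A sequence is a function $\underline m:\Phi^+\to\mathbb Z_{\ge0}$ with weight $\sum\underline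 m(\beta)\beta$; a pair $(\alpha,\beta)$ is the indicator of two distinct roots. $\underline m'<^{\mathtt b}_{\mathbf j}\underline m$ iff there are $k\le s$ with equal values at $\beta^{\mathbf j}_t$ for $t<k$ and $t>s$, and $\underline m'(\beta^{\mathbf j}_k)<\underline m(\beta^{\mathbf j}_k)$, $\underline m'(\beta^{\mathbf j}_s)<\underline m(\beta^{\mathbf j}_s)$; $\underline m'\prec^{\mathtt b}_{[\mathbf i_0]}\underline m$ iff this holds for all $\mathbf j\in[\mathbf i_0]$. A pair is simple if no sequence of the same weight is $\prec^{\mathtt b}_{[\mathbf i_0]}$ it; a sequence is simple if supported on one root or if all pairs in its support are simple. $\mathrm{gdist}_{[\mathbf i_0]}(\underline m)=0$ if $\underline m$ is simple, otherwise the maximal $k$ for which there is a chain of non-simple sequences $\underline m^{(1)}\prec^{\mathtt b}_{[\mathbf i_0]}\cdots\prec^{\mathtt b}_{[\mathbf i_0]}\underline m^{(k)}=\underline m$ of the same weight. For $k,l\in\bar I$ and an integer $t\ge0$, $\Phi_{[\mathbf i_0]}(k,l)[t]$ is the set of pairs $(\alpha,\beta)$ comparable under $\prec_{[\mathbf i_0]}$ with $\{\widehat\Omega_{[\mathbf i_0]}(\alpha),\widehat\Omega_{[\mathbf i_0]}(\beta)\}=\{(k,a),(l,b)\}$ and $|a-b|=t$. $\mathrm{gdist}_{[\mathbf i_0]}$ is constant on this set; its value is $o^{[\mathbf i_0]}_t(k,l)$ ($0$ if the set is empty). With $q_s^2=q$ ($q$ an indeterminate), $$\widehat D^{[\mathbf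 i_0]}_{k,l}(z)=\prod_{t\ge0}\bigl(z-(-1)^{k+l}q_s^{\,t}\bigr)^{\lceil o^{[\mathbf i_0]}_t(k,l)/2\rceil}.$$ *)

(* Defs.v *)
From HB Require Import structures.
From mathcomp Require Import all_boot all_order all_algebra all_fingroup.
From mathcomp Require Import boolp classical_sets functions cardinality fsbigop.

Set Implicit Arguments.
Unset Strict Implicit.
Unset Printing Implicit Defensive.

Import Order.TTheory GRing.Theory Num.Theory.

Local Open Scope classical_set_scope.
Local Open Scope ring_scope.

(* Letters are the Dynkin labels 1, ..., r of type A_r, as natural numbers,
   and the Weyl group of type A_r is 'S_r.+1.  The positions in a word and the
   coordinate vectors eps_a (a : 'I_r.+1) are numbered from 0, so that
   alpha_i = eps_(i-1) - eps_i. *)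
Notation word := (seq nat).

Section WeylGroup.
Variable r : nat.
Implicit Types w : word.

Definition letters_ok w : Prop := all (fun i => (0 < i <= r)%N) w.

Definition simple_refl (i : nat) : 'S_r.+1 := tperm (inord i.-1) (inord i).

(* s_(i_1) ... s_(i_N) as a composition of functions: the product of
   permutations composes from left to right, hence the reversal. *)
Definition weyl_elt w : 'S_r.+1 := (\prod_(i <- rev w) simple_refl i)%g.

Definition reduced w : Prop :=
  letters_ok w /\
  forall v, letters_ok v -> weyl_elt v = weyl_elt w -> (size w <= size v)%N.

Definition longest_elt : 'S_r.+1 := perm (@rev_ord_inj r.+1).

Definition reduced_longest w : Prop := reduced w /\ weyl_elt w = longest_elt.

End WeylGroup.

(* v is in the commutation class [w]. *)
Inductive comm_equiv : word -> word -> Prop :=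
| CommRefl w : comm_equiv w w
| CommSwap u v w i j : (i.+2 <= j)%N || (j.+2 <= i)%N ->
    comm_equiv w (u ++ i :: j :: v) -> comm_equiv w (u ++ j :: i :: v).

Definition is_sink (i : nat) (w : word) : Prop :=
  exists v, comm_equiv w (i :: v).

Definition is_source (i : nat) (w : word) : Prop :=
  exists v, comm_equiv w (rcons v i).

Section TwistedAdapted.
Variable n : nat.

(* Both i^* and i^vee. *)
Definition star (i : nat) : nat := (n.*2.+2 - i)%N.

(* [w'] = [w] r_i *)
Definition reflect_right (i : nat) (w w' : word) : Prop :=
  (exists v, comm_equiv w (i :: v) /\ comm_equiv (rcons v (star i)) w')
  \/ (~ is_sink i w /\ comm_equiv w w').

(* [w'] = r_i [w] *)
Definition reflect_left (i : nat) (w w' : word) : Prop :=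
  (exists v, comm_equiv w (rcons v i) /\ comm_equiv (star i :: v) w')
  \/ (~ is_source i w /\ comm_equiv w w').

Definition twisted_base : word :=
  flatten [seq map (iter k star) (iota 1 n.+1) | k <- iota 0 n.*2.+1].

(* The class [w] is twisted adapted. *)
Inductive twisted_adapted : word -> Prop :=
| TwBase w : comm_equiv twisted_base w -> twisted_adapted w
| TwRight i w w' : (0 < i <= n.*2.+1)%N ->
    twisted_adapted w -> reflect_right i w w' -> twisted_adapted w'
| TwLeft i w w' : (0 < i <= n.*2.+1)%N ->
    twisted_adapted w -> reflect_left i w w' -> twisted_adapted w'.

End TwistedAdapted.

(* The pair (a, b), a < b, stands for the positive root eps_a - eps_b of type
   A_(2n+1). *)
Notation posroot n :=
  {p : 'I_n.*2.+2 * 'I_n.*2.+2 | (p.1 < p.2)%N}.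

Section Roots.
Variable n : nat.

Definition root_vec (b : posroot n) : 'rV[int]_n.*2.+2 :=
  delta_mx 0 (val b).1 - delta_mx 0 (val b).2.

Definition highest_root : posroot n := exist _ (ord0, ord_max) isT.

(* s_(i_0) ... s_(i_(k-1)) (alpha_(i_k)), using u (eps_a) = eps_(u a).  It is
   a positive root when w is reduced, and the default value of [insubd] is
   then irrelevant. *)
Definition beta (w : word) (k : nat) : posroot n :=
  let u := weyl_elt n.*2.+1 (take k w) in
  let i := nth 0%N w k in
  insubd highest_root (u (inord i.-1), u (inord i)).

Definition root_prec (i0 : word) (a b : posroot n) : Prop :=
  forall w, comm_equiv i0 w ->
  exists j k, [/\ (j < k < size w)%N, beta w j = a & beta w k = b].

End Roots.

(* The arrow from beta_k to beta_j in the quiver Upsilon of [w]. *)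
Definition arrow (w : word) (k j : nat) : Prop :=
  let i_ := nth 0%N w in
  [/\ (i_ k).+1 = i_ j \/ (i_ j).+1 = i_ k,
      (j < k < size w)%N,
      forall t, (j < t < k)%N -> i_ t <> i_ j
    & forall t, (j < t < k)%N -> i_ t <> i_ k].

Section DynkinQuiver.

(* Q i j means that there is an arrow i -> j. *)
Definition dynkin_quiver (m : nat) (Q : rel nat) : Prop :=
  (forall i j, Q i j ->
     [/\ (0 < i <= m)%N, (0 < j <= m)%N & i.+1 = j \/ j.+1 = i])
  /\ (forall i, (0 < i)%N -> (i < m)%N -> Q i i.+1 (+) Q i.+1 i).

Definition quiver_sink (Q : rel nat) (i : nat) : Prop := forall j, ~~ Q i j.

Definition reverse_at (i : nat) (Q : rel nat) : rel nat :=
  fun a b => if (a == i) || (b == i) then Q b a else Q a b.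

Fixpoint adapted (Q : rel nat) (w : word) : Prop :=
  if w is i :: v then quiver_sink Q i /\ adapted (reverse_at i Q) v else True.

Definition height_function (Q : rel nat) (xi : nat -> int) : Prop :=
  forall i j, Q i j -> xi j = xi i + 1.

End DynkinQuiver.

Section Coordinates.
Variable n : nat.

Definition Pword (w : word) : word :=
  [seq (if (n.+2 <= j)%N then j.-1 else j) | j <- w & j != n.+1].

(* Om is the coordinate system Omega of [i0] for some choice of the height
   function xi (only xi up to an additive constant is free).  As positions are
   numbered from 0, the number c of earlier letters i is the "k - 1" of the
   k-th root of residue i. *)
Definition is_coordinate (i0 : word) (Om : posroot n -> nat * rat) : Prop :=
  exists (Q : rel nat) (xi : nat -> int),
    [/\ dynkin_quiver n.*2 Q,
        reduced_longest n.*2 (Pword i0),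
        adapted Q (Pword i0),
        height_function Q xi &
        forall k, (k < size i0)%N ->
          let i := nth 0%N i0 k in
          let c := count_mem i (take k i0) in
          [/\ (i <= n)%N ->
                Om (beta n i0 k) = (i, (xi i - (2 * c)%N%:Z)%:~R),
              (n.+2 <= i)%N ->
                Om (beta n i0 k) = (i, (xi i.-1 - (2 * c)%N%:Z)%:~R),
              i = n.+1 -> forall j, arrow i0 j k ->
                Om (beta n i0 k) = (n.+1, (Om (beta n i0 j)).2 + 2^-1)
            & i = n.+1 -> forall j, arrow i0 k j ->
                Om (beta n i0 k) = (n.+1, (Om (beta n i0 j)).2 - 2^-1)]].

Definition fold_coord (c : nat * rat) : nat * rat :=
  (minn c.1 (n.*2.+2 - c.1), 2 * c.2).

End Coordinates.

Section Distance.
Variables (n : nat) (i0 : word).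
Implicit Types m : {ffun posroot n -> nat}.

Definition weight m : 'rV[int]_n.*2.+2 := \sum_b root_vec b *+ m b.

Definition pair_seq (a b : posroot n) : {ffun posroot n -> nat} :=
  [ffun g => ((g == a) || (g == b)) : nat].

Definition bilex (w : word) m' m : Prop :=
  exists k s, [/\ (k <= s < size w)%N,
    forall t, (t < size w)%N -> (t < k)%N \/ (s < t)%N ->
      m' (beta n w t) = m (beta n w t),
    (m' (beta n w k) < m (beta n w k))%N
  & (m' (beta n w s) < m (beta n w s))%N].

Definition seq_prec m' m : Prop :=
  forall w, comm_equiv i0 w -> bilex w m' m.

Definition simple_pair (a b : posroot n) : Prop :=
  forall m, weight m = weight (pair_seq a b) -> ~ seq_prec m (pair_seq a b).

Definition simple_seq m : Prop :=
  (exists a, forall b, (0 < m b)%N <-> b = a)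
  \/ (forall a b, a <> b -> (0 < m a)%N -> (0 < m b)%N -> simple_pair a b).

(* There is a chain of length k of non-simple sequences ending at m. *)
Inductive gchain : nat -> {ffun posroot n -> nat} -> Prop :=
| GChain1 m : ~ simple_seq m -> gchain 1 m
| GChainS k m' m : gchain k m' -> ~ simple_seq m -> weight m' = weight m ->
    seq_prec m' m -> gchain k.+1 m.

(* [xget x0 A] is an element of A, or x0 if A is empty. *)
Definition gdist m : nat :=
  if `[< simple_seq m >] then 0%N
  else xget 0%N
    [set k | gchain k m /\ forall k', gchain k' m -> (k' <= k)%N].

Variable Om : posroot n -> nat * rat.

Definition folded_coord (b : posroot n) : nat * rat := fold_coord n (Om b).

Definition Phi_set (k l t : nat) : set (posroot n * posroot n) :=
  [set p | [/\ p.1 <> p.2,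
               root_prec i0 p.1 p.2 \/ root_prec i0 p.2 p.1
             & exists a b : rat,
                 [set folded_coord p.1; folded_coord p.2] = [set (k, a); (l, b)]
                 /\ `|a - b| = t%:R]].

(* The value of gdist on Phi_set k l t, on which it is constant. *)
Definition o_dist (k l t : nat) : nat :=
  xget 0%N [set d | exists2 p, Phi_set k l t p & gdist (pair_seq p.1 p.2) = d].

(* A polynomial in z over Z[q_s]: z is the outer indeterminate, q_s the inner
   one (and q = q_s ^+ 2).  All but finitely many factors are 1. *)
Definition folded_dist_poly (k l : nat) : {poly {poly int}} :=
  \big[*%R/1]_(t \in [set: nat])
    ('X - ((-1) ^+ (k + l) * 'X^t : {poly int})%:P) ^+ uphalf (o_dist k l t).

End Distance.

(* Main.v *)
Require Import Defs.
From HB Require Import structures.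
From mathcomp Require Import all_boot all_order all_algebra all_fingroup.
From mathcomp Require Import boolp classical_sets fsbigop.
From mathcomp Require Import zify ring.

(** Every twisted adapted class is a window into one periodic picture with
    many symmetries, and both ingredients of the folded distance polynomial,
    the folded coordinates and the statistic gdist, can be read off the
    picture without mentioning the window.

    The picture. Repeating the blocks 1 2 ... n+1 and their images under star
    in both directions gives a word without ends, whose wiring diagram has
    2n+2 wires: 2n+1 of them travel up and down over the full height, and one
    stays in the middle. A letter is a crossing of two wires and is recorded
    here by a label (a, b): the integers a and b name the wires which are
    below and above before the crossing, where two even integers name the same
    wire if they agree modulo 4n+2 and all odd integers name the middle wire.
    In these coordinates the order forced on the letters is the componentwise
    order, the letter is a function of b - a, the folded coordinate is the
    letter up to star together with a constant minus (a + b), and the root at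
    the crossing is eps_a - eps_b.

    Windows. A reflection functor deletes a minimal crossing (a, b) and
    appends (b, a + 4n+2), the next crossing of the same two wires. Hence a
    twisted adapted class consists of the linear extensions of the set of
    crossings z outside some lower set C such that the previous crossing of
    the wires of z lies in C (twisted_diagram, diagram_chart,
    diagram_coordinates).

    Constancy. A sequence below a pair x < y in the bi-lexicographic order is
    supported on the interval from x to y, so gdist of the pair is determined
    by that interval and by the linear relations between its roots
    (gdist_transfer). The picture has a group of screw translations,
    transitive on the crossings with a given folded letter, and a flip which
    reverses the order. Two comparable pairs with the same folded letters and
    the same time difference t are matched by a screw translation or by a
    screw translation after the flip, whichever windows they come from. So
    gdist is a function of k, l and t (gdist_related).

    Occurrence. One class may contain a pair with given k, l, t while another
    one does not, so it remains to see that gdist is then 0. If gdist is not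
    0, some sequence strictly inside the interval has the weight of the pair,
    and following its wires shows that t < 4n+2 (short_interval). A window
    without such a pair, on the other hand, would give a lower set C whose
    complement is stable under translation by 4n+2 - t blocks towards the
    past, which is impossible when t < 4n+2 (related_exists). Since the value
    for an empty set of pairs is 0 as well, the two polynomials have the same
    exponents (o_dist_charts). *)

Set Implicit Arguments.
Unset Strict Implicit.
Unset Printing Implicit Defensive.

Import Order.TTheory GRing.Theory Num.Theory.

Local Open Scope ring_scope.

(** * Crossings of the periodic wiring diagram *)

Definition label := (int * int)%type.

Section Labels.
Variable n : nat.
Implicit Types x y z : label.

Definition even_int (p : int) := (2 %| p)%Z.

(** A crossing of two travelling wires, named by even integers, or a crossing
    with the middle wire. The middle wire has height n+1/2 among the others,
    which forces b - a = 2n+1 there. *)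
Definition valid z : bool :=
  (z.2 - z.1 == n.*2.+1%:Z) ||
  [&& even_int z.1, even_int z.2 & 0 < z.2 - z.1 < (4 * n + 2)%:Z].

(** A travelling wire has one constant coordinate while it rises and one while
    it falls, so that this is the light cone of the crossing. *)
Definition label_le z y : bool := (z.1 <= y.1) && (z.2 <= y.2).

Definition label_lt z y : bool := (z != y) && label_le z y.

(** The height of the crossing. Heights above the middle wire are raised by
    one, to make room for the letter n+1. *)
Definition residue z : nat :=
  (`|z.2 - z.1|./2 + (n.*2 < `|z.2 - z.1|))%N.

Definition fresidue z : nat := minn (residue z) (n.*2.+2 - residue z).

(** The second folded coordinate, up to sign and an additive constant. *)
Definition time z : int := z.1 + z.2.

(** The next crossing of the same two wires, which trade the roles of lower
    and upper wire. *)
Definition next z : label := (z.2, z.1 + (4 * n + 2)%:Z).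
Definition prev z : label := (z.2 - (4 * n + 2)%:Z, z.1).

Definition same_wire (p q : int) : bool :=
  if even_int p then even_int q && ((4 * n + 2)%:Z %| p - q)%Z
  else ~~ even_int q.

Lemma small_multiple (m k x : int) : x = k * m -> - m < x < m -> k = 0.
Proof. nia. Qed.

Lemma same_wire_refl p : same_wire p p.
Proof. by rewrite /same_wire subrr dvdz0; case: (even_int p). Qed.

Lemma same_wire_evenP p q : even_int p ->
  reflect (exists k : int, p = q + k * (4 * n + 2)%:Z) (same_wire p q).
Proof.
rewrite /same_wire => ep; rewrite ep.
apply: (iffP andP) => [[_ /dvdzP [k hk]]|[k hk]].
  by exists k; rewrite -hk addrC subrK.
split; last by apply/dvdzP; exists k; lia.
by rewrite /even_int in ep *; lia.
Qed.

Lemma same_wire_odd p q : ~~ even_int p -> same_wire p q = ~~ even_int q.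
Proof. by rewrite /same_wire => /negbTE->. Qed.

Lemma same_wire_sym p q : same_wire p q = same_wire q p.
Proof.
rewrite /same_wire -[p - q]opprB rpredN.
by case: (even_int p); case: (even_int q).
Qed.

Lemma same_wire_near p q :
  even_int p -> same_wire p q -> - (4 * n + 2)%:Z < p - q < (4 * n + 2)%:Z -> p = q.
Proof.
move=> ep /(same_wire_evenP _ ep) [k hk] hb.
have k0 : k = 0 by apply: (@small_multiple (4 * n + 2)%:Z k (p - q)) => //; lia.
by rewrite hk k0; lia.
Qed.

Lemma same_wire_even p q : same_wire p q -> even_int q = even_int p.
Proof. by rewrite /same_wire; case: (even_int p) => [/andP[]|/negbTE]. Qed.

Lemma label_le_refl : reflexive label_le.
Proof. by move=> z; rewrite /label_le !lexx. Qed.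

Lemma label_le_trans : transitive label_le.
Proof. by move=> y x z; rewrite /label_le; lia. Qed.

Lemma pair_neqE x y : (x != y) = (x.1 != y.1) || (x.2 != y.2).
Proof. by case: x y => [a b] [c d]; rewrite xpair_eqE negb_and. Qed.

Lemma label_ltE x y : label_lt x y = label_le x y && (time x < time y).
Proof.
by rewrite /label_lt pair_neqE /label_le /time; lia.
Qed.

Lemma label_lt_trans : transitive label_lt.
Proof. by move=> y x z; rewrite !label_ltE /label_le /time; lia. Qed.

Lemma label_lt_irr x : label_lt x x = false.
Proof. by rewrite /label_lt eqxx. Qed.

Lemma prevK : cancel prev next.
Proof. by case=> a b; rewrite /prev /next /=; congr pair; lia. Qed.
Lemma nextK : cancel next prev.
Proof. by case=> a b; rewrite /prev /next /=; congr pair; lia. Qed.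

Lemma valid_next z : valid (next z) = valid z.
Proof. by case: z => a b; rewrite /valid /next /even_int /=; lia. Qed.
Lemma valid_prev z : valid (prev z) = valid z.
Proof. by rewrite -{2}(prevK z) valid_next. Qed.
Lemma label_le_prev x y : label_le (prev x) (prev y) = label_le x y.
Proof. by rewrite /label_le /prev /=; lia. Qed.

Lemma residue_bound z : valid z -> (0 < residue z <= n.*2.+1)%N.
Proof. by case: z => a b; rewrite /valid /residue /even_int /=; lia. Qed.

Lemma residue_next z : valid z -> residue (next z) = star n (residue z).
Proof. by case: z => a b; rewrite /valid /residue /next /star /even_int /=; lia. Qed.

(** Letters that do not commute are always ordered. Together with far_between
    this makes a commutation class the set of all linear extensions of one
    order. *)
Lemma near_comparable x y : valid x -> valid y ->
  (residue x <= (residue y).+1)%N -> (residue y <= (residue x).+1)%N ->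
  label_le x y || label_le y x.
Proof.
case: x y => [a b] [c d]; rewrite /valid /residue /label_le /even_int /=; lia.
Qed.

(** The crossings of two travelling wires, at height r, in a form that settles
    all parities. *)
Definition travelling (u : int) (r : nat) : label := (2 * u, 2 * u + 2 * r%:Z).

Lemma travellingP z : valid z -> residue z != n.+1 ->
  exists u r, z = travelling u r /\ (0 < r <= n.*2)%N.
Proof.
case: z => a b; rewrite /valid /residue /even_int /= => v hr.
exists (a %/ 2)%Z, (`|b - a|./2)%N; split; last by lia.
by congr pair; lia.
Qed.

Lemma middleP z : valid z -> residue z = n.+1 -> z = (z.1, z.1 + n.*2.+1%:Z).
Proof.
by case: z => a b; rewrite /valid /residue /even_int /= => v hr; congr pair; lia.
Qed.

Lemma residue_middle a : residue (a, a + n.*2.+1%:Z) = n.+1.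
Proof. by rewrite /residue /=; lia. Qed.

Lemma residue_travelling u r : residue (travelling u r) = (r + (n < r))%N.
Proof. by rewrite /residue /=; lia. Qed.

Lemma valid_middle a b : b = a + n.*2.+1%:Z -> valid (a, b).
Proof. by move=> ->; rewrite /valid /= addrAC subrr add0r eqxx. Qed.

Lemma valid_travelling a b u r : a = 2 * u -> b = a + 2 * r%:Z -> (0 < r <= n.*2)%N -> valid (a, b).
Proof. by move=> -> -> hr; rewrite /valid /even_int /=; lia. Qed.

(** A comparison between letters that commute is never a covering relation:
    moving one step from x towards the height of y stays below y. *)
Lemma far_between x y : valid x -> valid y -> label_lt x y ->
  ((residue x).+2 <= residue y)%N || ((residue y).+2 <= residue x)%N ->
  exists2 z, valid z & label_lt x z && label_lt z y.
Proof.
have [rx|rx] := eqVneq (residue x) n.+1; have [ry|ry] := eqVneq (residue y) n.+1.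
- by rewrite rx ry; lia.
- move=> vx vy; rewrite (middleP vx rx); move: x.1 => a.
  have [v [q [-> hq]]] := travellingP vy ry.
  rewrite residue_middle residue_travelling !label_ltE /label_le /time /= => lxy.
  case/orP => hr; case: (boolP (even_int a)) => ea; have ea' := ea; rewrite /even_int in ea'.
  + exists (a, a + n.*2.+2%:Z); last by rewrite !label_ltE /label_le /time /=; lia.
    by apply: (@valid_travelling _ _ (a %/ 2)%Z n.+1); lia.
  + exists (a + 1, a + n.*2%:Z + 3); last by rewrite !label_ltE /label_le /time /=; lia.
    by apply: (@valid_travelling _ _ ((a + 1) %/ 2)%Z n.+1); lia.
  + exists (a + 2, a + n.*2.+2%:Z); last by rewrite !label_ltE /label_le /time /=; lia.
    by apply: (@valid_travelling _ _ ((a + 2) %/ 2)%Z n); lia.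
  + exists (a + 1, a + n.*2.+1%:Z); last by rewrite !label_ltE /label_le /time /=; lia.
    by apply: (@valid_travelling _ _ ((a + 1) %/ 2)%Z n); lia.
- move=> vx vy; rewrite (middleP vy ry); move: y.1 => c.
  have [u [r [-> hr]]] := travellingP vx rx.
  rewrite residue_middle residue_travelling !label_ltE /label_le /time /= => lxy.
  case/orP => h.
    exists (2 * u, 2 * u + 2 * r.+1%:Z); last by rewrite !label_ltE /label_le /time /=; lia.
    by apply: (@valid_travelling _ _ u r.+1); lia.
  exists (2 * u + 2, 2 * u + 2 * r%:Z); last by rewrite !label_ltE /label_le /time /=; lia.
  by apply: (@valid_travelling _ _ (u + 1) r.-1); lia.
move=> vx vy; have [u [r [-> hr]]] := travellingP vx rx.
have [v [q [-> hq]]] := travellingP vy ry.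
rewrite !residue_travelling !label_ltE /label_le /time /= => lxy.
case/orP => h.
  have [E|ne] := eqVneq r n.
    exists (2 * u, 2 * u + 2 * r%:Z + 1); last by rewrite !label_ltE /label_le /time /=; lia.
    by apply: valid_middle; lia.
  exists (2 * u, 2 * u + 2 * r.+1%:Z); last by rewrite !label_ltE /label_le /time /=; lia.
  by apply: (@valid_travelling _ _ u r.+1); lia.
have [E|ne] := eqVneq r n.+1.
  exists (2 * u + 1, 2 * u + 2 * r%:Z); last by rewrite !label_ltE /label_le /time /=; lia.
  by apply: valid_middle; lia.
exists (2 * u + 2, 2 * u + 2 * r%:Z); last by rewrite !label_ltE /label_le /time /=; lia.
by apply: (@valid_travelling _ _ (u + 1) r.-1); lia.
Qed.

(** Parity tells a letter from its image under star: at a given time at most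
    one of the two occurs. *)
Lemma fresidue_time_inj x y : valid x -> valid y ->
  fresidue x = fresidue y -> time x = time y -> x = y.
Proof.
have [rx|rx] := eqVneq (residue x) n.+1; have [ry|ry] := eqVneq (residue y) n.+1;
  move=> vx vy; rewrite /fresidue.
- rewrite (middleP vx rx) (middleP vy ry) /time /= => _ h.
  have -> : x.1 = y.1 by lia.
  by [].
- have [v [q [-> hq]]] := travellingP vy ry; rewrite rx residue_travelling; lia.
- have [u [r [-> hr]]] := travellingP vx rx; rewrite ry residue_travelling; lia.
have [u [r [-> hr]]] := travellingP vx rx; have [v [q [-> hq]]] := travellingP vy ry.
rewrite !residue_travelling /time /= => h t.
have E : r = q by lia.
rewrite E; have -> : u = v by lia.
by [].
Qed.

End Labels.

(** * Weight balance inside an interval *)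

Section Wires.
Variable n : nat.
Implicit Types x y z : label.
Local Notation valid := (valid n).
Local Notation same_wire := (same_wire n).

(** The coefficient at the wire named j of the root of z. *)
Definition wires z (j : int) : int :=
  (same_wire z.1 j)%:Z - (same_wire z.2 j)%:Z.

Lemma same_wire_shift p q c : even_int c -> same_wire (p + c) q = same_wire p (q - c).
Proof.
rewrite /same_wire => ec.
have -> : even_int (p + c) = even_int p by rewrite /even_int in ec *; lia.
have -> : even_int (q - c) = even_int q by rewrite /even_int in ec *; lia.
by have -> : p + c - q = p - (q - c) by lia.
Qed.

Lemma same_wire_opp p q : same_wire (- p) q = same_wire p (- q).
Proof.
rewrite /same_wire.
have -> : even_int (- p) = even_int p by rewrite /even_int; lia.
have -> : even_int (- q) = even_int q by rewrite /even_int; lia.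
have -> : - p - q = - (p - - q) by lia.
by rewrite rpredN.
Qed.

Lemma same_wire_period p q : same_wire p (q - (4 * n + 2)%:Z) = same_wire p q.
Proof.
rewrite /same_wire.
have -> : even_int (q - (4 * n + 2)%:Z) = even_int q by rewrite /even_int; lia.
have -> : p - (q - (4 * n + 2)%:Z) = p - q + (4 * n + 2)%:Z by lia.
by rewrite rpredDr ?dvdzz.
Qed.

Lemma no_source_sum_le0 (s : seq label) (m : label -> nat) j :
    (forall z, z \in s -> (0 < m z)%N -> ~~ same_wire z.1 j) ->
  \sum_(z <- s) wires z j *+ m z <= 0.
Proof.
move=> h; rewrite big_seq; apply: sumr_le0 => z zs.
case: (posnP (m z)) => [->|mz]; first by rewrite mulr0n.
by rewrite /wires (negbTE (h z zs mz)) mulrn_wle0 //; case: (same_wire _ _).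
Qed.

(** A wire at which roots end but none starts has a negative coefficient. This
    is how a sequence is shown not to have the prescribed weight. *)
Lemma no_source_sum_lt0 (s : seq label) (m : label -> nat) j z :
    (forall z, z \in s -> (0 < m z)%N -> ~~ same_wire z.1 j) ->
    z \in s -> (0 < m z)%N -> same_wire z.2 j ->
  \sum_(z <- s) wires z j *+ m z < 0.
Proof.
move=> h zs mz hz; rewrite (perm_big _ (perm_to_rem zs)) big_cons.
have h1 : wires z j *+ m z < 0.
  by rewrite /wires (negbTE (h z zs mz)) hz /= sub0r mulNrn oppr_lt0 pmulrn_rgt0.
apply: ltr_wnDr h1; apply: no_source_sum_le0 => y ys my.
by apply: (h y) => //; apply: mem_rem ys.
Qed.

Lemma source_of_pos (s : seq label) (m : label -> nat) j :
    0 < \sum_(z <- s) wires z j *+ m z ->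
  exists z, [/\ z \in s, (0 < m z)%N & same_wire z.1 j].
Proof.
move=> h; apply: contrapT => hn; move: h; rewrite ltNge => /negP; apply.
apply: no_source_sum_le0 => z zs mz; apply/negP => hz; apply: hn.
by exists z.
Qed.

Lemma source_of_target (s : seq label) (m : label -> nat) j z :
    0 <= \sum_(z <- s) wires z j *+ m z ->
    z \in s -> (0 < m z)%N -> same_wire z.2 j ->
  exists z, [/\ z \in s, (0 < m z)%N & same_wire z.1 j].
Proof.
move=> h zs mz hz; apply: contrapT => hn; move: h; rewrite leNgt => /negP; apply.
apply: no_source_sum_lt0 zs mz hz => y ys my; apply/negP => hy; apply: hn.
by exists y.
Qed.

Lemma same_wire_distinct p q :
  - (4 * n + 2)%:Z < p - q < (4 * n + 2)%:Z -> even_int q -> p != q -> same_wire p q = false.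
Proof.
move=> hb eq ne; apply/negP => h; case/negP: ne; apply/eqP.
have ep : even_int p by rewrite -(same_wire_even h).
exact: same_wire_near ep h hb.
Qed.

(** Let x = (a, b) and y = (c, d) be far apart, so that a <= c < b < a + 4n+2
    < d. Lower wires of the crossings in the interval are named by [a, c] and
    upper ones by [b, d]. A crossing whose upper wire is even and strictly
    between b and a + 4n+2 leaves at that wire a negative coefficient, which
    nothing cancels and which the weight of the pair does not have. The wire
    a, or the middle wire if a is odd, has a positive coefficient, so it is
    the lower wire of some crossing other than x, and this crossing leads to
    the forbidden situation, if necessary after passing through the middle
    wire once. *)
Lemma short_interval_left x y (s : seq label) (m : label -> nat) :
    valid x -> valid y -> label_le x y -> y.1 < x.2 ->
    (forall z, z \in s -> (0 < m z)%N -> [/\ valid z, label_lt x z & label_lt z y]) ->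
    (forall j, \sum_(z <- s) wires z j *+ m z = wires x j + wires y j) ->
  time y - time x < (4 * n + 2)%:Z.
Proof.
case: x y => [a b] [c d] /= vx vy lxy cb hs hw.
rewrite ltNge; apply/negP; rewrite /time /= => ht.
have da : a + (4 * n + 2)%:Z < d by lia.
have dc : d < c + (4 * n + 2)%:Z by move: vy; rewrite /valid /=; lia.
have ab : a < b < a + (4 * n + 2)%:Z by move: vx; rewrite /valid /=; lia.
have ac : a <= c by move: lxy; rewrite /label_le /=; lia.
have box z : z \in s -> (0 < m z)%N ->
  [/\ valid z, z != (a, b), a <= z.1 <= c & b <= z.2 <= d].
  move=> zs mz; have [vz /andP [ne]] := hs z zs mz.
  rewrite /label_lt /label_le /= => h1 /andP [_ h2]; split=> //; first by rewrite eq_sym.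
    by lia.
  by lia.
have key z : z \in s -> (0 < m z)%N -> even_int z.2 ->
    b < z.2 -> z.2 < a + (4 * n + 2)%:Z -> False.
  move=> zs mz ez h1 h2.
  have : \sum_(y <- s) wires y z.2 *+ m y < 0.
    apply: (no_source_sum_lt0 _ zs mz (same_wire_refl _ _)) => y ys my.
    by have [_ _ ? _] := box y ys my; rewrite same_wire_distinct //; lia.
  have wd : same_wire d z.2 = false.
    rewrite same_wire_sym -same_wire_period same_wire_sym same_wire_distinct //; rewrite /even_int in ez *; lia.
  rewrite hw /wires /= wd !same_wire_distinct //; lia.
(* If a is odd, key excludes any other crossing with the middle wire below. *)
case: (boolP (even_int a)) => ea; last first.
  have eb : even_int b by move: vx; rewrite /valid /even_int /= in ea *; lia.
  have ecd : even_int c /\ even_int d.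
    by move: vx vy; rewrite /valid /even_int /= in ea *; lia.
  have [|[p q] [zs mz]] := @source_of_pos s m a.
    rewrite hw /wires /= same_wire_refl.
    rewrite ![same_wire _ a]same_wire_sym !(same_wire_odd _ _ ea) eb ecd.1 ecd.2 //.
  rewrite same_wire_sym (same_wire_odd _ _ ea) /= => op.
  have [/= vz ne hp hq] := box _ zs mz.
  by apply: (key _ zs mz) => /=; move: vz ne vx; rewrite pair_neqE /valid /even_int /= in ea op *; lia.
have [|[p q] [zs mz]] := @source_of_pos s m a.
  have da' : same_wire d a = false.
    rewrite same_wire_sym -same_wire_period same_wire_sym same_wire_distinct //; lia.
  rewrite hw /wires /= same_wire_refl da' (@same_wire_distinct b) //; lia.
have [/= vz ne hp hq] := box _ zs mz.
rewrite same_wire_sym => hpa.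
have {hpa} pa : p = a by apply/esym/(same_wire_near ea hpa); lia.
have bq : b < q by move: ne; rewrite pair_neqE /=; lia.
have qa : q < a + (4 * n + 2)%:Z by move: vz; rewrite /valid /=; lia.
case: (boolP (even_int q)) => eq; first exact: (key _ zs mz).
have ebcd : [/\ even_int b, even_int c & even_int d].
  by split; move: vx vy vz; rewrite /valid /even_int /= in ea eq *; lia.
(* Here q is the middle wire, which the weight of the pair does not involve,
   so some crossing in the interval must also start from it. *)
have [|[p' q'] [zs' mz']] := @source_of_target s m q _ _ zs mz (same_wire_refl _ _).
  rewrite hw /wires /= ![same_wire _ q]same_wire_sym !(same_wire_odd _ _ eq).
  by case: ebcd => -> -> ->; rewrite ea.
rewrite same_wire_sym (same_wire_odd _ _ eq) /= => op'.
have [/= vz' ne' hp' hq'] := box _ zs' mz'.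
have Eq : q = p + n.*2.+1%:Z.
  by move: vz {vz'}; rewrite /valid /even_int /= in ea eq *; lia.
have [Eq' eq'] : q' = p' + n.*2.+1%:Z /\ even_int q'.
  by move: vz' {vz}; rewrite /valid /even_int /= in op' *; lia.
have ap' : a < p'.
  by rewrite lt_neqAle; case/andP: hp' => -> _; rewrite andbT; apply: contraNneq op' => <-.
by apply: (key _ zs' mz') => //=; clear - Eq Eq' ap' pa bq hp' cb; lia.
Qed.
End Wires.

(** * Screw translations and the flip *)

Section Symmetries.
Variable n : nat.
Implicit Types x y z : label.
Local Notation valid := (valid n).
Local Notation next := (next n).
Local Notation prev := (prev n).
Local Notation wires := (wires n).
Local Notation same_wire := (same_wire n).
Local Notation fresidue := (fresidue n).

(** Translation by j blocks of the periodic word. An odd number of blocks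
    exchanges rising and falling wires. *)
Definition screw (j : int) z : label :=
  if even_int j then (z.1 + j, z.2 + j)
  else (z.2 - n.*2%:Z + j - 1, z.1 + n.*2.+1%:Z + j).

Definition flip z : label := (- z.2, - z.1).

(** The flag r tells whether the order is reversed. The last condition says
    that g pulls coefficient functionals of weights back to multiples of such
    functionals, so that g preserves equality of weights. *)
Definition symmetry (r : bool) (g : label -> label) : Prop :=
  [/\ forall z, valid (g z) = valid z,
      forall x y, label_le (g x) (g y) = if r then label_le y x else label_le x y
    & forall j, exists (s : int) i, forall z, wires (g z) j = s * wires z i].

Lemma symmetry_comp r r' g g' :
  symmetry r g -> symmetry r' g' -> symmetry (r (+) r') (g \o g').
Proof.
move=> [gv gl gw] [gv' gl' gw']; split=> [z|x y|j] /=.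
- by rewrite gv gv'.
- by rewrite gl; case: r {gl} => /=; rewrite gl'; case: r' {gl'}.
have [s [i hi]] := gw j; have [s' [i' hi']] := gw' i.
by exists (s * s'), i' => z; rewrite hi hi' mulrA.
Qed.

Lemma valid_screw j z : valid (screw j z) = valid z.
Proof.
case: z => a b; rewrite /screw; case: (boolP (even_int j));
  rewrite /valid /even_int /=; lia.
Qed.

Lemma screw_symmetry j : symmetry false (screw j).
Proof.
split=> [z|x y|i]; first exact: valid_screw.
  by case: x y => [a b] [c d]; rewrite /screw; case: (even_int j); rewrite /label_le /=; lia.
case: (boolP (even_int j)) => ej.
  exists 1, (i - j) => z; rewrite mul1r /wires /screw ej /= !same_wire_shift //.
exists (-1), (i + n.*2.+1%:Z - j) => z; rewrite mulN1r /wires /screw (negbTE ej) /= opprB.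
have -> : z.2 - n.*2%:Z + j - 1 = z.2 + (j - n.*2.+1%:Z) by lia.
have -> : z.1 + n.*2.+1%:Z + j = z.1 + (j + n.*2.+1%:Z) by lia.
rewrite !same_wire_shift; try by rewrite /even_int in ej *; lia.
rewrite -(same_wire_period n z.1 (i + _ - j)); congr (_%:Z - _%:Z); congr (nat_of_bool (same_wire _ _)); lia.
Qed.

Lemma flip_symmetry : symmetry true flip.
Proof.
split=> [z|x y|i].
- by case: z => a b; rewrite /flip /valid /even_int /=; lia.
- by rewrite /flip /label_le /=; lia.
exists (-1), (- i) => z; rewrite mulN1r /wires /flip /= opprB !same_wire_opp //.
Qed.

Lemma screw_add j k z : screw j (screw k z) = screw (j + k) z.
Proof.
rewrite /screw /even_int.
by case: (boolP (2 %| j)%Z); case: (boolP (2 %| k)%Z);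
   case: (boolP (2 %| j + k)%Z) => /= *; congr pair; lia.
Qed.

Lemma screw0 z : screw 0 z = z.
Proof. by case: z => a b; rewrite /screw /= !addr0. Qed.

Lemma flipK : involutive flip.
Proof. by case=> a b; rewrite /flip /= !opprK. Qed.

Lemma next_screw z : next z = screw n.*2.+1%:Z z.
Proof.
rewrite /screw; case: ifP; first by rewrite /even_int; lia.
by move=> _; rewrite /next; congr pair; lia.
Qed.

Lemma prev_screw z : prev z = screw (- n.*2.+1%:Z) z.
Proof. by apply: (can_inj (@nextK n)); rewrite prevK next_screw screw_add addrN screw0. Qed.

Lemma time_screw j z : time (screw j z) = time z + 2 * j.
Proof. by rewrite /screw /time; case: (even_int j) => /=; lia. Qed.

Lemma residue_diff x y : x.2 - x.1 = y.2 - y.1 -> residue n x = residue n y.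
Proof. by rewrite /residue => ->. Qed.

Lemma fresidue_screw j z : valid z -> fresidue (screw j z) = fresidue z.
Proof.
move=> vz; rewrite /fresidue /screw; case: (even_int j).
  by rewrite (@residue_diff _ z) //= opprD addrACA subrr addr0.
rewrite (@residue_diff _ (next z)) /=; last by lia.
by rewrite residue_next // /star; have := residue_bound vz; lia.
Qed.

Lemma fresidue_flip z : fresidue (flip z) = fresidue z.
Proof. by case: z => a b; rewrite /fresidue /residue /flip /= opprK addrC. Qed.

Lemma time_flip z : time (flip z) = - time z.
Proof. by rewrite /time /flip /=; lia. Qed.

Lemma valid_flip z : valid (flip z) = valid z.
Proof. by case: flip_symmetry. Qed.

Lemma screw_orbit x y : valid x -> valid y -> fresidue x = fresidue y ->
  exists j, screw j x = y.
Proof.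
move=> vx vy hf.
have [k hk] : exists k, time y = time x + 2 * k.
  move: hf; have [rx|rx] := eqVneq (residue n x) n.+1; have [ry|ry] := eqVneq (residue n y) n.+1;
    rewrite /fresidue.
  - rewrite (middleP vx rx) (middleP vy ry) /time /= => _.
    by exists (y.1 - x.1); lia.
  - have [v [q [-> hq]]] := travellingP vy ry; rewrite rx residue_travelling; lia.
  - have [u [r [-> hr]]] := travellingP vx rx; rewrite ry residue_travelling; lia.
  have [u [r [-> hr]]] := travellingP vx rx; have [v [q [-> hq]]] := travellingP vy ry.
  by rewrite /time /= => _; exists (2 * v + q%:Z - 2 * u - r%:Z); lia.
exists k; apply: (@fresidue_time_inj n); rewrite ?valid_screw ?fresidue_screw //.
by rewrite time_screw hk.
Qed.

Lemma flip_screw z : valid z -> flip z = screw (- time z) z.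
Proof.
move=> vz; apply: (@fresidue_time_inj n); rewrite ?valid_screw ?valid_flip //.
  by rewrite fresidue_screw // fresidue_flip.
by rewrite time_screw time_flip; lia.
Qed.

(** Since y is not above next x, one coordinate of y is small. The translation
    by one block exchanges the two coordinates, which reduces the second case
    to the first. *)
Lemma short_interval x y (s : seq label) (m : label -> nat) :
    valid x -> valid y -> label_le x y -> ~~ label_le (next x) y ->
    (forall z, z \in s -> (0 < m z)%N -> [/\ valid z, label_lt x z & label_lt z y]) ->
    (forall j, \sum_(z <- s) wires z j *+ m z = wires x j + wires y j) ->
  time y - time x < (4 * n + 2)%:Z.
Proof.
move=> vx vy lxy nxy hs hw.
case: (ltP y.1 x.2) => h; first exact: short_interval_left hs hw.
have h2 : y.2 < x.1 + (4 * n + 2)%:Z by move: nxy; rewrite /label_le /next /=; lia.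
suff : time (screw 1 y) - time (screw 1 x) < (4 * n + 2)%:Z by rewrite !time_screw; lia.
have [_ sl sw] := screw_symmetry 1.
apply: (@short_interval_left n _ _ (map (screw 1) s) (fun z => m (screw (-1) z)));
  rewrite ?valid_screw ?sl //.
- by rewrite /screw /=; lia.
- move=> _ /mapP [z zs ->]; rewrite screw_add screw0 => mz.
  have [vz xz zy] := hs z zs mz; rewrite valid_screw; split=> //.
    by move: xz; rewrite !label_ltE !sl !time_screw ltrD2r.
  by move: zy; rewrite !label_ltE !sl !time_screw ltrD2r.
move=> j; have [t [i hi]] := sw j.
rewrite !hi -mulrDr -hw big_map mulr_sumr; apply: eq_bigr => z _.
by rewrite hi screw_add screw0 mulrnAr.
Qed.

End Symmetries.

(** * The statistic gdist depends on an interval only *)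

Section Extremal.
Variable B : finType.
Implicit Types (lt : rel B) (rank : B -> int) (m : {ffun B -> nat}).

Definition ends_below lt m' m : Prop :=
  forall z, m' z != m z -> (forall y, lt y z -> m' y = m y) -> (m' z < m z)%N.

(** Among the linear extensions of lt, every minimal point of disagreement
    comes first in some extension, and every maximal one comes last. So this
    is the intersection of the bi-lexicographic orders of all linear
    extensions. *)
Definition extremal_prec lt m' m : Prop :=
  [/\ m' <> m, ends_below lt m' m & ends_below (fun y z => lt z y) m' m].

Definition supported (A : pred B) m : Prop := forall z, m z != 0%N -> A z.

Definition convex lt (A : pred B) : Prop :=
  forall x z y, A x -> A y -> (x == z) || lt x z -> (z == y) || lt z y -> A z.

(** A strictly monotone rank replaces a well-foundedness argument: take a
    point of disagreement below z of least rank. *)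
Lemma first_difference lt rank m' m z :
    transitive lt -> (forall x y, lt x y -> rank x < rank y) -> m' z != m z ->
  exists x, [/\ (x == z) || lt x z, m' x != m x
              & forall y, lt y x -> m' y = m y].
Proof.
move=> tr mono hz.
pose P x := ((x == z) || lt x z) && (m' x != m x).
have Pz : P z by rewrite /P eqxx.
case: (Order.TotalTheory.arg_minP rank Pz) => x /andP [xz hx] xmin.
exists x; split=> // y yx; apply/eqP; apply: contraT => hy.
have : rank x <= rank y.
  apply: xmin; rewrite /P hy andbT.
  by case/orP: xz => [/eqP <-|/(tr _ _ _ yx) ->]; rewrite ?yx orbT.
by rewrite leNgt (mono _ _ yx).
Qed.

(** Where m vanishes but m' does not, the disagreement has extremal points
    below and above it, and there m is positive. Convexity of A does the rest.
    *)
Lemma extremal_prec_supported lt rank (A : pred B) m' m :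
    transitive lt -> (forall x y, lt x y -> rank x < rank y) -> convex lt A ->
    supported A m -> extremal_prec lt m' m ->
  supported A m'.
Proof.
move=> tr mono cA sm [_ lo hi] z mz.
case: (eqVneq (m z) 0%N) => [m0|]; last exact: sm.
have hz : m' z != m z by rewrite m0.
have [x [xz hx xmin]] := first_difference tr mono hz.
have tr' : transitive (fun y z => lt z y) by move=> a b c h1 h2; apply: tr h2 h1.
have mono' a b : lt b a -> - rank a < - rank b by move/mono; rewrite ltrN2.
have [y [yz hy ymax]] := first_difference tr' mono' hz.
apply: (cA x z y).
- by apply: sm; have := lo x hx xmin; case: (m x).
- by apply: sm; have := hi y hy ymax; case: (m y).
- by [].
by case/orP: yz => [/eqP ->|->]; rewrite ?eqxx ?orbT.
Qed.
End Extremal.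

Section Transport.
Variable n : nat.
Local Notation root := (posroot n).
Implicit Types (m : {ffun root -> nat}).

(** What gdist needs to know about the class of w near the convex set A of
    roots. *)
Record poset_of (w : seq nat) (lt : rel root) (A : pred root) : Prop := PosetOf {
  poset_prec : forall m' m, seq_prec w m' m <-> extremal_prec lt m' m;
  poset_trans : transitive lt;
  poset_rank : exists rank : root -> int, forall x y, lt x y -> rank x < rank y;
  poset_convex : convex lt A }.

(** Push-forward of a sequence along a partial bijection with inverse psi,
    extended by 0 outside A'. *)
Definition transfer (A' : pred root) (psi : root -> root) m : {ffun root -> nat} :=
  [ffun b => if A' b then m (psi b) else 0%N].

(** A partial bijection between two sets of roots, possibly in different
    classes, which preserves or reverses the convex order and preserves
    equality of weights. *)
Record interval_iso (r : bool) (lt : rel root) (A : pred root)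
    (lt' : rel root) (A' : pred root) (phi psi : root -> root) : Prop := IntervalIso {
  iso_to : forall b, A b -> A' (phi b);
  iso_from : forall b, A' b -> A (psi b);
  iso_K : forall b, A b -> psi (phi b) = b;
  iso_VK : forall b, A' b -> phi (psi b) = b;
  iso_lt : forall x y, A x -> A y ->
    lt x y = if r then lt' (phi y) (phi x) else lt' (phi x) (phi y);
  iso_weight : forall m1 m2, supported A m1 -> supported A m2 ->
    weight m1 = weight m2 -> weight (transfer A' psi m1) = weight (transfer A' psi m2);
  iso_weightV : forall m1 m2, supported A' m1 -> supported A' m2 ->
    weight m1 = weight m2 -> weight (transfer A phi m1) = weight (transfer A phi m2) }.

Lemma interval_iso_sym r lt A lt' A' phi psi :
  interval_iso r lt A lt' A' phi psi -> interval_iso r lt' A' lt A psi phi.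
Proof.
case=> h1 h2 h3 h4 h5 h6 h7; split=> // x y Ax Ay.
by case: r h5 => h5; rewrite h5 ?h4 //; apply: h2.
Qed.

Lemma extremal_prec_transfer r lt A lt' A' phi psi m' m :
    interval_iso r lt A lt' A' phi psi ->
    supported A m' -> supported A m -> extremal_prec lt m' m ->
  extremal_prec lt' (transfer A' psi m') (transfer A' psi m).
Proof.
move=> I sm' sm [ne lo hi].
have E (v : {ffun root -> nat}) b : A b -> transfer A' psi v (phi b) = v b.
  by move=> Ab; rewrite ffunE (iso_to I Ab) (iso_K I Ab).
have out (y : root) : ~~ A y -> m' y = m y.
  move=> nA; have -> : m' y = 0%N by apply/eqP; apply: contraNT nA; apply: sm'.
  by apply/esym/eqP; apply: contraNT nA; apply: sm.
have inside z : transfer A' psi m' z != transfer A' psi m z -> A' z.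
  by rewrite !ffunE; case: ifP.
have back z (R R' : rel root) : A' z ->
    (forall x y, A x -> A y -> R x y -> R' (phi x) (phi y)) ->
    (forall y, R' y z -> transfer A' psi m' y = transfer A' psi m y) ->
    forall y, R y (psi z) -> m' y = m y.
  move=> Az hR h y hy; case: (boolP (A y)) => [Ay|]; last exact: out.
  by rewrite -!(E _ _ Ay); apply: h; rewrite -(iso_VK I Az); exact: hR Ay (iso_from I Az) hy.
split.
- move=> h; apply: ne; apply/ffunP => z; case: (boolP (A z)) => [Az|]; last exact: out.
  by rewrite -!(E _ _ Az) h.
- move=> z hz hmin; have Az := inside z hz.
  move: hz; rewrite !ffunE Az => hz.
  case: r I hmin => I hmin.
    apply: hi => //; apply: (back z (fun y z => lt z y) lt') => // x y Ax Ay; by rewrite (iso_lt I Ay Ax).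
  by apply: lo => //; apply: (back z lt lt') => // x y Ax Ay; rewrite (iso_lt I Ax Ay).
- move=> z hz hmax; have Az := inside z hz.
  move: hz; rewrite !ffunE Az => hz.
  case: r I hmax => I hmax.
    apply: lo => //; apply: (back z lt (fun y z => lt' z y)) => // x y Ax Ay.
    by rewrite (iso_lt I Ax Ay).
  apply: hi => //; apply: (back z (fun y z => lt z y) (fun y z => lt' z y)) => // x y Ax Ay.
  by rewrite (iso_lt I Ay Ax).
Qed.

Lemma supported_transfer A' psi m : supported A' (transfer A' psi m).
Proof. by move=> z; rewrite ffunE; case: (A' z). Qed.

Lemma transferK r lt A lt' A' phi psi m :
    interval_iso r lt A lt' A' phi psi -> supported A m ->
  transfer A phi (transfer A' psi m) = m.
Proof.
move=> I sm; apply/ffunP => z; rewrite !ffunE; case: (boolP (A z)) => Az.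
  by rewrite (iso_to I Az) (iso_K I Az).
by apply/esym/eqP; apply: contraNT Az; apply: sm.
Qed.

Lemma pair_seq_supported (A : pred root) a b : A a -> A b -> supported A (pair_seq a b).
Proof.
by move=> Aa Ab z; rewrite ffunE; case: (z =P a) => [->//|_]; case: (z =P b) => [->//|].
Qed.

Lemma transfer_pair r lt A lt' A' phi psi a b :
    interval_iso r lt A lt' A' phi psi -> A a -> A b ->
  transfer A' psi (pair_seq a b) = pair_seq (phi a) (phi b).
Proof.
move=> I Aa Ab; apply/ffunP => z; rewrite !ffunE; case: (boolP (A' z)) => Az.
  have E c : A c -> (psi z == c) = (z == phi c).
    by move=> Ac; apply/eqP/eqP => [<-|->]; rewrite ?(iso_VK I) ?(iso_K I).
  by rewrite !E.
case: (z =P phi a) => [h|_]; first by rewrite h (iso_to I) in Az.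
by case: (z =P phi b) => [h|_] //; rewrite h (iso_to I) in Az.
Qed.

Variables (r : bool) (w w' : seq nat) (lt lt' : rel root) (A A' : pred root).
Variables (phi psi : root -> root).
Hypothesis P : poset_of w lt A.
Hypothesis P' : poset_of w' lt' A'.
Hypothesis I : interval_iso r lt A lt' A' phi psi.

Lemma seq_prec_supported m' m : supported A m -> seq_prec w m' m -> supported A m'.
Proof.
have [rank mono] := poset_rank P.
move=> sm /(poset_prec P); apply: extremal_prec_supported (poset_trans P) mono _ sm.
exact: poset_convex P.
Qed.

Lemma seq_prec_transfer m' m : supported A m -> seq_prec w m' m ->
  seq_prec w' (transfer A' psi m') (transfer A' psi m).
Proof.
move=> sm hm; apply/(poset_prec P'); apply: (extremal_prec_transfer I) => //.
  exact: seq_prec_supported hm.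
exact/(poset_prec P).
Qed.
End Transport.

Section Gdist.
Variable n : nat.
Local Notation root := (posroot n).
Implicit Types (m : {ffun root -> nat}).

Lemma simple_pair_transfer r w w' lt lt' (A A' : pred root) phi psi a b :
    poset_of w lt A -> poset_of w' lt' A' -> interval_iso r lt A lt' A' phi psi ->
    A a -> A b ->
  simple_pair w a b -> simple_pair w' (phi a) (phi b).
Proof.
move=> P P' I Aa Ab h M hM pM; have I' := interval_iso_sym I.
have sp : supported A' (pair_seq (phi a) (phi b)).
  by apply: pair_seq_supported; apply: (iso_to I).
have sM := seq_prec_supported P' sp pM.
have E : transfer A phi (pair_seq (phi a) (phi b)) = pair_seq a b.
  by rewrite -(transfer_pair I Aa Ab) (transferK I) //; apply: pair_seq_supported.
apply: (h (transfer A phi M)); rewrite -E.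
  exact: iso_weight I' _ _ sM sp hM.
exact: seq_prec_transfer P' P I' _ _ sp pM.
Qed.

Lemma simple_seq_transfer r w w' lt lt' (A A' : pred root) phi psi m :
    poset_of w lt A -> poset_of w' lt' A' -> interval_iso r lt A lt' A' phi psi ->
    supported A m ->
  simple_seq w m -> simple_seq w' (transfer A' psi m).
Proof.
move=> P P' I sm [[a ha]|h]; [left|right].
  have Aa : A a by apply: sm; rewrite -lt0n; apply/ha.
  exists (phi a) => b; rewrite ffunE; split.
    by case: ifP => // Ab /ha <-; rewrite (iso_VK I).
  by move=> ->; rewrite (iso_to I Aa) (iso_K I Aa); apply/ha.
move=> a b nab; rewrite !ffunE; case: ifP => // Aa ma; case: ifP => // Ab mb.
rewrite -(iso_VK I Aa) -(iso_VK I Ab).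
apply: (simple_pair_transfer P P' I); try exact: (iso_from I).
by apply: h => // E; apply: nab; rewrite -(iso_VK I Aa) E (iso_VK I Ab).
Qed.

Lemma simple_seq_iso r w w' lt lt' (A A' : pred root) phi psi m :
    poset_of w lt A -> poset_of w' lt' A' -> interval_iso r lt A lt' A' phi psi ->
    supported A m ->
  simple_seq w m <-> simple_seq w' (transfer A' psi m).
Proof.
move=> P P' I sm; split; first exact: simple_seq_transfer P P' I sm.
move/(simple_seq_transfer P' P (interval_iso_sym I)).
by rewrite (transferK I) //; apply; apply: supported_transfer.
Qed.

Lemma gchain_transfer r w w' lt lt' (A A' : pred root) phi psi k m :
    poset_of w lt A -> poset_of w' lt' A' -> interval_iso r lt A lt' A' phi psi ->
    supported A m ->
  gchain w k m -> gchain w' k (transfer A' psi m).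
Proof.
move=> P P' I sm c; elim: c sm => {k m} [m ns sm|k m' m _ IH ns hw hp sm].
  by apply: GChain1 => /(simple_seq_iso P P' I sm).
have sm' := seq_prec_supported P sm hp.
apply: (GChainS (IH sm')).
- by move/(simple_seq_iso P P' I sm).
- exact: iso_weight I _ _ sm' sm hw.
exact: seq_prec_transfer P P' I _ _ sm hp.
Qed.

(** Simplicity and chains below m involve sequences supported on A only
    (seq_prec_supported), and all of these are carried over by transfer in
    both directions. *)
Lemma gdist_transfer r w w' lt lt' (A A' : pred root) phi psi m :
    poset_of w lt A -> poset_of w' lt' A' -> interval_iso r lt A lt' A' phi psi ->
    supported A m ->
  gdist w m = gdist w' (transfer A' psi m).
Proof.
move=> P P' I sm.
have G k : gchain w k m <-> gchain w' k (transfer A' psi m).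
  split; first exact: gchain_transfer P P' I sm.
  move/(gchain_transfer P' P (interval_iso_sym I)).
  by rewrite (transferK I) //; apply; apply: supported_transfer.
rewrite /gdist (asbool_equiv_eq (simple_seq_iso P P' I sm)).
case: ifP => // _; congr xget; apply/seteqP; split=> k [/G h1 h2]; split=> // k' /G; exact: h2.
Qed.
End Gdist.

(** * Roots of a word as crossings in a window *)

Section Charts.
Variable n : nat.
Local Notation root := (posroot n).
Implicit Types (m : {ffun root -> nat}) (C : pred label) (L : root -> label).
Implicit Types (a b : root).
Local Notation valid := (valid n).
Local Notation prev := (prev n).
Local Notation wires := (wires n).
Local Notation fresidue := (fresidue n).
Local Notation screw := (screw n).

(** The bound makes every screw translation orbit enter C in the past and
    leave it in the future. *)
Record lower_cut C : Prop := LowerCut {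
  cut_down : forall x y, valid x -> valid y -> label_le x y -> C y -> C x;
  cut_bound : exists B : int, forall z, valid z ->
    (z.1 <= - B -> C z) /\ (B <= z.1 -> ~~ C z) }.

(** The description of a class by crossings: L sends the roots bijectively
    onto the crossings outside C whose predecessor on the same wires is in C,
    and turns the convex order, the order on sequences and the weights into
    those of the picture. *)
Record chart (w : seq nat) C L : Prop := Chart {
  chart_cut : lower_cut C;
  chart_valid : forall b, valid (L b);
  chart_inj : injective L;
  chart_window : forall b, ~~ C (L b) && C (prev (L b));
  chart_onto : forall z, valid z -> ~~ C z -> C (prev z) -> exists b, L b = z;
  chart_root_prec : forall a b, root_prec w a b <-> label_lt (L a) (L b);
  chart_seq_prec : forall m' m,
    seq_prec w m' m <-> extremal_prec (relpre L label_lt) m' m;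
  chart_weight : forall m1 m2, weight m1 = weight m2 <->
    forall j, \sum_b wires (L b) j *+ m1 b = \sum_b wires (L b) j *+ m2 b }.

Definition between L a b : pred root := fun z => label_le (L a) (L z) && label_le (L z) (L b).

(** The default value b0 only serves labels outside the image of L. *)
Definition root_at L b0 z : root := odflt b0 [pick b | L b == z].

Lemma root_atP L b0 z : (exists b, L b = z) -> L (root_at L b0 z) = z.
Proof.
by rewrite /root_at => -[b hb]; case: pickP => [c /eqP //|/(_ b)]; rewrite hb eqxx.
Qed.

Lemma root_atK w C L b0 b : chart w C L -> root_at L b0 (L b) = b.
Proof. by move=> ch; apply: (chart_inj ch); apply: root_atP; exists b. Qed.

Lemma label_le_eqVlt x y : label_le x y = (x == y) || label_lt x y.
Proof. by rewrite /label_lt; case: eqVneq => [->|] //; rewrite label_le_refl. Qed.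

(** Windows are convex in the set of all crossings, hence intervals do not
    depend on the window in which they are seen. *)
Lemma chart_interval w C L a b z : chart w C L -> valid z ->
  label_le (L a) z -> label_le z (L b) -> exists c, L c = z.
Proof.
move=> ch vz az zb; have cut := chart_cut ch; have V := chart_valid ch.
have /andP [Ca _] := chart_window ch a; have /andP [_ Cb] := chart_window ch b.
apply: (chart_onto ch vz).
  by apply: contra Ca; exact: (cut_down cut (V a) vz az).
by apply: (cut_down cut) Cb; rewrite ?valid_prev ?label_le_prev ?V.
Qed.

Lemma chart_poset w C L a b : chart w C L -> poset_of w (relpre L label_lt) (between L a b).
Proof.
move=> ch; split.
- exact: chart_seq_prec ch.
- by move=> y x z; apply: label_lt_trans.
- by exists (fun b => time (L b)) => x y; rewrite /= label_ltE => /andP[].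
move=> x z y /andP [ax _] /andP [_ yb] xz zy.
have {}xz : label_le (L x) (L z) by rewrite label_le_eqVlt; case/orP: xz => [/eqP ->|/= ->]; rewrite ?eqxx ?orbT.
have {}zy : label_le (L z) (L y) by rewrite label_le_eqVlt; case/orP: zy => [/eqP ->|/= ->]; rewrite ?eqxx ?orbT.
by rewrite /between (label_le_trans ax xz) (label_le_trans zy yb).
Qed.

Definition move_root L L' (g : label -> label) b : root := root_at L' b (g (L b)).

(** The symmetry g carries the interval from a to b onto the interval from a'
    to b', upside down if r holds. *)
Definition ends_match (r : bool) L L' (g : label -> label) a b a' b' : Prop :=
  L' a' = g (L (if r then b else a)) /\ L' b' = g (L (if r then a else b)).

Lemma move_rootP r w w' C C' L L' g a b a' b' z :
    chart w C L -> chart w' C' L' -> symmetry n r g -> ends_match r L L' g a b a' b' ->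
    between L a b z ->
  L' (move_root L L' g z) = g (L z) /\ between L' a' b' (move_root L L' g z).
Proof.
move=> ch ch' [gv gl _] [ha hb] /andP [az zb].
have az' : label_le (L' a') (g (L z)) by rewrite ha gl; case: r {gl} ha hb.
have zb' : label_le (g (L z)) (L' b') by rewrite hb gl; case: r {gl} ha hb.
have E : L' (move_root L L' g z) = g (L z).
  by apply/root_atP/(chart_interval ch' _ az' zb'); rewrite gv (chart_valid ch).
by rewrite /between E az' zb'.
Qed.

Lemma weight_transfer r w w' C C' L L' g h a b a' b' m1 m2 :
    chart w C L -> chart w' C' L' -> symmetry n r g -> symmetry n r h ->
    cancel g h -> cancel h g ->
    ends_match r L L' g a b a' b' -> ends_match r L' L h a' b' a b ->
    supported (between L a b) m1 -> supported (between L a b) m2 ->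
    weight m1 = weight m2 ->
  weight (transfer (between L' a' b') (move_root L' L h) m1) =
  weight (transfer (between L' a' b') (move_root L' L h) m2).
Proof.
move=> ch ch' sg sh gh hg eg eh s1 s2 /(chart_weight ch) hw.
apply/(chart_weight ch') => j; have [_ _ gw] := sg; have [s [i hi]] := gw j.
have to z := @move_rootP r w w' C C' L L' g a b a' b' z ch ch' sg eg.
have from z := @move_rootP r w' w C' C L' L h a' b' a b z ch' ch sh eh.
have K z : between L a b z -> move_root L' L h (move_root L L' g z) = z.
  move=> Az; have [h1 h2] := to z Az; have [h3 _] := from _ h2.
  by apply: (chart_inj ch); rewrite h3 h1 gh.
have VK z : between L' a' b' z -> move_root L L' g (move_root L' L h z) = z.
  move=> Az; have [h1 h2] := from z Az; have [h3 _] := to _ h2.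
  by apply: (chart_inj ch'); rewrite h3 h1 hg.
suff E m : supported (between L a b) m ->
    \sum_c wires (L' c) j *+ transfer (between L' a' b') (move_root L' L h) m c
    = s * \sum_c wires (L c) i *+ m c.
  by rewrite !E // hw.
move=> sm; rewrite (bigID (between L' a' b')) /= [X in _ + X]big1 ?addr0; last first.
  by move=> c /negbTE nc; rewrite ffunE nc mulr0n.
rewrite (reindex_onto (move_root L L' g) (move_root L' L h)) //=.
rewrite (bigID (between L a b)) /= [X in _ + X]big1 ?addr0; last first.
  move=> c /andP [/andP [h1 /eqP h2] /negP []].
  by rewrite -h2; have [] := from _ h1.
rewrite [in RHS](bigID (between L a b)) /= [X in _ * (_ + X)]big1 ?addr0; last first.
  move=> c nc; suff -> : m c = 0%N by rewrite mulr0n.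
  by apply/eqP; apply: contraNT nc; apply: sm.
rewrite mulr_sumr; apply: eq_big => [c|c /andP [/andP [h1 h2] Ac]].
  apply/idP/idP => [/andP[]//|Ac]; rewrite Ac K // eqxx !andbT.
  by have [] := to _ Ac.
by rewrite ffunE h1 K // (to _ Ac).1 hi mulrnAr.
Qed.

Lemma pair_seqC a b : pair_seq a b = pair_seq b a.
Proof. by apply/ffunP => z; rewrite !ffunE orbC. Qed.

(** A symmetry of the picture restricts to an isomorphism of intervals,
    because intervals are contained in every window that contains their ends.
    *)
Lemma gdist_pair_symmetry r w w' C C' L L' g h a b a' b' :
    chart w C L -> chart w' C' L' -> symmetry n r g -> symmetry n r h ->
    cancel g h -> cancel h g -> ends_match r L L' g a b a' b' ->
    label_le (L a) (L b) ->
  gdist w (pair_seq a b) = gdist w' (pair_seq a' b').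
Proof.
move=> ch ch' sg sh gh hg eg ab.
have eh : ends_match r L' L h a' b' a b.
  by case: eg; case: r {sg sh} => ha hb; split; rewrite ?ha ?hb gh.
have to z := @move_rootP r w w' C C' L L' g a b a' b' z ch ch' sg eg.
have from z := @move_rootP r w' w C' C L' L h a' b' a b z ch' ch sh eh.
have I : interval_iso r (relpre L label_lt) (between L a b) (relpre L' label_lt) (between L' a' b')
    (move_root L L' g) (move_root L' L h).
  split.
  - by move=> z Az; have [] := to z Az.
  - by move=> z Az; have [] := from z Az.
  - move=> z Az; have [h1 h2] := to z Az; have [h3 _] := from _ h2.
    by apply: (chart_inj ch); rewrite h3 h1 gh.
  - move=> z Az; have [h1 h2] := from z Az; have [h3 _] := to _ h2.
    by apply: (chart_inj ch'); rewrite h3 h1 hg.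
  - move=> x y Ax Ay /=; rewrite (to x Ax).1 (to y Ay).1.
    case: sg => _ gl _; rewrite /label_lt !gl !(inj_eq (can_inj gh)) [L y == _]eq_sym.
    by case: (r).
  - by move=> m1 m2; apply: weight_transfer ch ch' sg sh gh hg eg eh.
  - by move=> m1 m2; apply: weight_transfer ch' ch sh sg hg gh eh eg.
have Aa : between L a b a by rewrite /between label_le_refl ab.
have Ab : between L a b b by rewrite /between label_le_refl ab.
rewrite (gdist_transfer (chart_poset a b ch) (chart_poset a' b' ch') I); last first.
  exact: pair_seq_supported.
rewrite (transfer_pair I Aa Ab).
have [Ea _] := to a Aa; have [Eb _] := to b Ab; case: eg.
case: (r) => ha hb.
  have -> : move_root L L' g a = b' by apply: (chart_inj ch'); rewrite Ea hb.
  have -> : move_root L L' g b = a' by apply: (chart_inj ch'); rewrite Eb ha.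
  by rewrite pair_seqC.
have -> : move_root L L' g a = a' by apply: (chart_inj ch'); rewrite Ea ha.
by have -> : move_root L L' g b = b' by apply: (chart_inj ch'); rewrite Eb hb.
Qed.

(** A comparable pair which contributes to the distance t between the folded
    letters k and l, listed in the convex order. *)
Definition related (k l t : nat) x y : Prop :=
  [/\ label_lt x y, time y - time x = t%:Z
    & (fresidue x = k /\ fresidue y = l) \/ (fresidue x = l /\ fresidue y = k)].

(** If the folded letters of the two pairs occur in the same order, a screw
    translation matches the lower ends, and then the upper ends as well,
    having equal time and equal folded letter. If they occur in opposite
    order, the flip is applied first. *)
Lemma gdist_related k l t w w' C C' L L' a b a' b' :
    chart w C L -> chart w' C' L' ->
    related k l t (L a) (L b) -> related k l t (L' a') (L' b') ->
  gdist w (pair_seq a b) = gdist w' (pair_seq a' b').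
Proof.
move=> ch ch' [ab tab hf] [ab' tab' hf'].
have V := chart_valid ch; have V' := chart_valid ch'.
have lab : label_le (L a) (L b) by case/andP: ab.
have screwK j : cancel (screw j) (screw (- j)).
  by move=> z; rewrite screw_add addNr screw0.
have screwVK j : cancel (screw (- j)) (screw j).
  by move=> z; rewrite screw_add addrN screw0.
have direct : fresidue (L a) = fresidue (L' a') -> fresidue (L b) = fresidue (L' b') ->
    gdist w (pair_seq a b) = gdist w' (pair_seq a' b').
  move=> ha hb; have [j hj] := screw_orbit (V a) (V' a') ha.
  apply: (@gdist_pair_symmetry false w w' C C' L L' (screw j) (screw (- j))) => //;
    try exact: screw_symmetry.
  split=> //; apply: (@fresidue_time_inj n); rewrite ?valid_screw ?fresidue_screw //.
  have := congr1 time hj; rewrite !time_screw => h.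
  by lia.
have reversed : fresidue (L b) = fresidue (L' a') -> fresidue (L a) = fresidue (L' b') ->
    gdist w (pair_seq a b) = gdist w' (pair_seq a' b').
  move=> ha hb; have [||j hj] := @screw_orbit n (flip (L b)) _ _ (V' a').
  - by rewrite valid_flip.
  - by rewrite fresidue_flip.
  apply: (@gdist_pair_symmetry true w w' C C' L L' (screw j \o flip) (flip \o screw (- j))) => //.
  - exact: (symmetry_comp (screw_symmetry n j) (flip_symmetry n)).
  - exact: (symmetry_comp (flip_symmetry n) (screw_symmetry n _)).
  - by move=> z /=; rewrite screwK flipK.
  - by move=> z /=; rewrite flipK screwVK.
  split=> //=; apply: (@fresidue_time_inj n);
    rewrite ?valid_screw ?fresidue_screw ?valid_flip ?fresidue_flip //.
  have := congr1 time hj; rewrite !time_screw !time_flip => h.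
  by lia.
case: hf hf' => [] [h1 h2] [] [h3 h4].
- by apply: direct; rewrite ?h1 ?h2.
- by apply: reversed; rewrite ?h1 ?h2.
- by apply: reversed; rewrite ?h1 ?h2.
- by apply: direct; rewrite ?h1 ?h2.
Qed.

Lemma root_vec_neq0 b : root_vec b != 0.
Proof.
apply/eqP => /rowP /(_ (val b).1); rewrite !mxE !eqxx /=.
by have := valP b; case: eqVneq => [->|_] //; rewrite ltnn.
Qed.

(** The extremal disagreements of m with the pair lie at a and b, and m
    vanishes there. If m did not vanish at both, it would agree with the pair
    except at one root and would have a different weight. *)
Lemma pair_prec_between (lt : rel root) (rank : root -> int) a b m :
    transitive lt -> (forall x y, lt x y -> rank x < rank y) -> lt a b ->
    extremal_prec lt m (pair_seq a b) -> weight m = weight (pair_seq a b) ->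
  forall z, (0 < m z)%N -> lt a z /\ lt z b.
Proof.
move=> tr mono ab [ne lo hi] hw.
have ba : lt b a = false by apply/negP => /(tr _ _ _ ab) /mono; rewrite ltxx.
have irr x : lt x x = false by apply/negP => /mono; rewrite ltxx.
have small x : (m x < pair_seq a b x)%N -> m x = 0%N /\ (x = a \/ x = b).
  rewrite ffunE; case: (x =P a) => [->|_] /=; first by case: (m a) => //; auto.
  by case: (x =P b) => [->|_] //=; case: (m b) => //; auto.
have bounds z : m z != pair_seq a b z -> exists x y,
    [/\ (x == z) || lt x z, (z == y) || lt z y, m x = 0%N /\ (x = a \/ x = b)
      & m y = 0%N /\ (y = a \/ y = b)].
  move=> hz; have [x [xz hx xmin]] := first_difference tr mono hz.
  have tr' : transitive (fun y z => lt z y) by move=> u v t h1 h2; apply: tr h2 h1.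
  have mono' u v : lt v u -> - rank u < - rank v by move/mono; rewrite ltrN2.
  have [y [yz hy ymax]] := first_difference tr' mono' hz.
  exists x, y; split=> //; first by rewrite eq_sym.
    exact/small/lo.
  exact/small/hi.
have zero_ends c : c = a \/ c = b -> m c = 0%N.
  move=> hc; apply/eqP; apply: contraT => mc.
  (* If m does not vanish at the end c, every disagreement is at the other end d. *)
  pose d := if c == a then b else a.
  have only z : m z != pair_seq a b z -> z = d.
    case/bounds => x [y [xz zy [mx xab] [my yab]]].
    have end_d u : m u = 0%N -> u = a \/ u = b -> u = d.
      rewrite /d => mu; case: (c =P a) => [ca|nca] [] uE //.
        by rewrite ca -uE mu in mc.
      by case: hc => // cb; rewrite cb -uE mu in mc.
    move: xz zy; rewrite (end_d x) // (end_d y) //.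
    case/orP => [/eqP //|dz] /orP [/eqP //|zd].
    by have := tr _ _ _ dz zd; rewrite irr.
  have pd : pair_seq a b d = 1%N.
    by rewrite ffunE /d; case: (c == a); rewrite eqxx ?orbT.
  have /eqP md : m d == 0%N.
    apply: contraT => md; exfalso; apply: ne; apply/ffunP => z.
    apply/eqP; apply: contraT => hz.
    have [x [y [_ _ [mx xab] _]]] := bounds z hz.
    have hd := only _ hz; rewrite hd in hz.
    have ex : m x != pair_seq a b x.
      by rewrite mx ffunE; case: xab => ->; rewrite eqxx ?orbT.
    by rewrite -(only _ ex) mx in md.
  have : weight (pair_seq a b) = weight m + root_vec d.
    rewrite /weight (bigD1 d) //= [in RHS](bigD1 d) //= md pd mulr0n add0r mulr1n addrC.
    congr (_ + _); apply: eq_bigr => z zd; congr (_ *+ _).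
    by apply/esym/eqP; apply: contraNT zd => /only ->.
  rewrite -hw => /eqP; rewrite -subr_eq0 opprD addrA subrr sub0r oppr_eq0.
  by rewrite (negbTE (root_vec_neq0 d)).
move=> z mz.
have za : z <> a by move=> E; rewrite E zero_ends in mz; auto.
have zb : z <> b by move=> E; rewrite E zero_ends in mz; auto.
have hz : m z != pair_seq a b z.
  by rewrite ffunE (introF eqP za) (introF eqP zb) -lt0n.
have [x [y [xz zy [_ xab] [_ yab]]]] := bounds z hz.
have {}xz : lt x z by case/orP: xz => // /eqP E; case: xab => F; case: za; subst.
have {}zy : lt z y by case/orP: zy => // /eqP E; case: yab => F; case: za; subst.
have xy := tr _ _ _ xz zy.
case: xab yab xz zy xy => -> [->|->] //; rewrite ?irr ?ba //.
Qed.

End Charts.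

(** * Equality of the folded distance polynomials *)

Section Invariance.
Variable n : nat.
Local Notation root := (posroot n).
Implicit Types (m : {ffun root -> nat}) (C : pred label) (L : root -> label).
Implicit Types (a b : root).
Local Notation valid := (valid n).
Local Notation prev := (prev n).
Local Notation fresidue := (fresidue n).
Local Notation screw := (screw n).
Local Notation related := (related n).

Lemma sum_pair_seq (F : root -> int) a b : a != b ->
  \sum_c F c *+ pair_seq a b c = F a + F b.
Proof.
move=> ab; rewrite (bigD1 a) //= (bigD1 b) 1?eq_sym //= big1 => [|c /andP [ca cb]].
  by rewrite !ffunE !eqxx orbT !mulr1n addr0.
by rewrite ffunE (negbTE ca) (negbTE cb).
Qed.

(** A pair that is not simple has the same weight as a sequence supported
    strictly inside its interval. *)
Lemma nonsimple_short w C L a b : chart w C L -> label_lt (L a) (L b) ->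
  gdist w (pair_seq a b) <> 0%N -> time (L b) - time (L a) < (4 * n + 2)%:Z.
Proof.
move=> ch ab; rewrite /gdist; case: asboolP => // ns _.
have nab : a != b by apply/eqP => E; move: ab; rewrite E label_lt_irr.
have [m hw hm] : exists2 m, weight m = weight (pair_seq a b) & seq_prec w m (pair_seq a b).
  apply: contrapT => h; apply: ns; right => u v nuv hu hv m hw hm; apply: h.
  have ab2 c : (0 < pair_seq a b c)%N -> c = a \/ c = b.
    by rewrite ffunE; case: (c =P a); case: (c =P b); auto.
  suff E : pair_seq a b = pair_seq u v by exists m; rewrite E.
  move: nuv; case: (ab2 u hu) => ->; case: (ab2 v hv) => -> // _.
  by rewrite pair_seqC.
have V := chart_valid ch.
have strict z : (0 < m z)%N -> label_lt (L a) (L z) && label_lt (L z) (L b).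
  move=> mz; apply/andP.
  apply: (@pair_prec_between _ (relpre L label_lt) (fun z => time (L z)) a b m _ _ ab) mz => //.
  - by move=> y x z'; apply: label_lt_trans.
  - by move=> x y; rewrite /= label_ltE => /andP[].
  - exact/(chart_seq_prec ch).
have lab : label_le (L a) (L b) by case/andP: ab.
apply: (@short_interval n (L a) (L b) (map L (enum (root : finType))) (fun z => m (root_at L a z))) => //.
- have /andP [Ca _] := chart_window ch a; have /andP [_ Cb] := chart_window ch b.
  apply: contra Ca => h; apply: (cut_down (chart_cut ch)) Cb; rewrite ?valid_prev //.
  by rewrite -(nextK n (L a)) label_le_prev.
- move=> _ /mapP [z _ ->]; rewrite (root_atK a z ch) => /strict /andP [h1 h2]; split=> //.
- move=> j; rewrite big_map big_enum /=.
  under eq_bigr do rewrite (root_atK a _ ch).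
  by rewrite ((chart_weight ch _ _).1 hw) sum_pair_seq.
Qed.

Lemma screw_low C x : lower_cut n C -> valid x ->
  exists J : int, forall j, j <= J -> C (screw j x).
Proof.
move=> [_ [B hB]] vx; exists (- B - `|x.1| - `|x.2|) => j hj.
have [|h _] := hB (screw j x); first by rewrite valid_screw.
by apply: h; rewrite /screw; case: (even_int j) => /=; lia.
Qed.

Lemma screw_high C x : lower_cut n C -> valid x -> exists j, ~~ C (screw j x).
Proof.
move=> [_ [B hB]] vx; exists (2 * (`|B| + `|x.1|)).
have [|_ h] := hB (screw (2 * (`|B| + `|x.1|)) x); first by rewrite valid_screw.
by apply: h; rewrite /screw /even_int; case: ifP => /=; lia.
Qed.

Lemma label_lt_screw j x y : label_lt (screw j x) (screw j y) = label_lt x y.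
Proof.
have [_ h _] := screw_symmetry n j.
by rewrite !label_ltE h !time_screw; congr (_ && _); lia.
Qed.

Lemma related_screw k l t j x y : valid x -> valid y ->
  related k l t x y -> related k l t (screw j x) (screw j y).
Proof.
by move=> vx vy [h1 h2 h3]; split; rewrite ?label_lt_screw ?time_screw ?fresidue_screw //; lia.
Qed.

Lemma related_flip k l t x y : related k l t x y -> related k l t (flip y) (flip x).
Proof.
move=> [h1 h2 h3]; split; rewrite ?time_flip ?fresidue_flip; [|lia|tauto].
have [_ h _] := flip_symmetry n; move: h1; rewrite !label_ltE h !time_flip; lia.
Qed.

(** Otherwise, whenever a translate of x lies outside C, the translate of y in
    the same position ends outside the window, that is, its predecessor is
    outside C. The same holds for the flipped pair, and applying both leads
    from a translate of x outside C to the one 4n+2 - t blocks earlier, again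
    outside C. Far enough in the past this contradicts the bound of C. *)
Lemma related_exists k l t w C L x y : chart w C L -> valid x -> valid y ->
    related k l t x y -> t%:Z < (4 * n + 2)%:Z ->
  exists a b, related k l t (L a) (L b).
Proof.
move=> ch vx vy rxy ht; apply: contrapT => no; have cut := chart_cut ch.
have step u v j : valid u -> valid v -> related k l t u v ->
    ~~ C (screw j u) -> ~~ C (prev (screw j v)).
  move=> vu vv /(related_screw j vu vv) ruv Cu; apply/negP => Cv; apply: no.
  have [/andP [_ luv] _ _] := ruv.
  have [|||a ha] := chart_onto ch (z := screw j u); rewrite ?valid_screw //.
    by apply: (cut_down cut) Cv; rewrite ?valid_prev ?valid_screw // label_le_prev.
  have [||| b hb] := chart_onto ch (z := screw j v); rewrite ?valid_screw //.
    by apply: contra Cu; apply: (cut_down cut); rewrite ?valid_screw.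
  by exists a, b; rewrite ha hb.
have vfx : valid (flip x) by rewrite valid_flip.
have vfy : valid (flip y) by rewrite valid_flip.
(* One step for the pair and one for its flip. *)
have descend j : ~~ C (screw j x) -> ~~ C (screw (j - ((4 * n + 2)%:Z - t%:Z)) x).
  move/(step _ _ _ vx vy rxy); rewrite prev_screw screw_add => h.
  have {h} : ~~ C (screw (- n.*2.+1%:Z + j + time y) (flip y)).
    by rewrite (@flip_screw n) // screw_add addrK.
  move/(step _ _ _ vfy vfx (related_flip rxy)); rewrite prev_screw screw_add (@flip_screw n) //.
  rewrite screw_add; case: rxy => _ hxy _.
  by congr (~~ C (screw _ _)); lia.
have [j hj] := screw_high cut vx; have [J hJ] := screw_low cut vx.
have all_steps N : ~~ C (screw (j - ((4 * n + 2)%:Z - t%:Z) * N%:Z) x).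
  elim: N => [|N IH]; first by rewrite mulr0 subr0.
  by have := descend _ IH; congr (~~ C (screw _ _)); lia.
have /negP := all_steps `|j - J|%N; apply; apply: hJ.
have : `|j - J| <= ((4 * n + 2)%:Z - t%:Z) * `|j - J|%N%:Z.
  by rewrite -[X in X <= _]mul1r abszE ler_wpM2r // ; lia.
lia.
Qed.

(** The constant K reflects that the height function is determined up to an
    additive constant. *)
Definition coordinates_of L (Om : root -> nat * rat) : Prop :=
  exists K : rat, forall b, fold_coord n (Om b) = (fresidue (L b), K - (time (L b))%:~R).

Lemma Phi_related w C L Om k l t p : chart w C L -> coordinates_of L Om ->
  Phi_set w Om k l t p ->
  exists a b, related k l t (L a) (L b) /\ pair_seq p.1 p.2 = pair_seq a b.
Proof.
move=> ch [K hK]; case: p => p q [/= npq hc [a [b [hs ht]]]].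
have comp : label_lt (L p) (L q) \/ label_lt (L q) (L p).
  by case: hc => /(chart_root_prec ch); auto.
have hfc : (folded_coord Om p = (k, a) /\ folded_coord Om q = (l, b)) \/
           (folded_coord Om p = (l, b) /\ folded_coord Om q = (k, a)).
  move/seteqP: hs => [h1 h2].
  have := h1 _ (or_introl erefl); have := h1 _ (or_intror erefl).
  have := h2 _ (or_introl erefl); have := h2 _ (or_intror erefl).
  by case=> e1 [] e2 [] e3 [] e4; first [left; split; congruence|right; split; congruence].
have {}ht : `|time (L p) - time (L q)| = t%:Z.
  apply/eqP; rewrite -(eqr_int rat) intr_norm rmorphB /=; apply/eqP; rewrite -[RHS]ht.
  case: hfc; rewrite /folded_coord !hK => -[[_ <-] [_ <-]].
    by rewrite -normrN; congr `|_|; ring.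
  by congr `|_|; ring.
have hf : (fresidue (L p) = k /\ fresidue (L q) = l) \/
          (fresidue (L p) = l /\ fresidue (L q) = k).
  by case: hfc; rewrite /folded_coord !hK => -[[-> _] [-> _]]; auto.
case: comp => h; [exists p, q|exists q, p]; split; rewrite 1?pair_seqC //; split=> //;
  move: h; rewrite label_ltE ?[pair_seq q p]pair_seqC; try lia; tauto.
Qed.

Lemma related_Phi w C L Om k l t a b : chart w C L -> coordinates_of L Om ->
  related k l t (L a) (L b) -> Phi_set w Om k l t (a, b).
Proof.
move=> ch [K hK] [ab tab hf]; split=> /=.
- by move=> E; move: ab; rewrite E label_lt_irr.
- by left; apply/(chart_root_prec ch).
have norm c d : `|(K - c%:~R) - (K - d%:~R)| = `|d - c|%:~R :> rat.
  by rewrite intr_norm rmorphB /=; congr `|_|; ring.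
case: hf => -[ha hb].
  exists (K - (time (L a))%:~R), (K - (time (L b))%:~R); rewrite norm tab.
  by rewrite /folded_coord !hK ha hb.
exists (K - (time (L b))%:~R), (K - (time (L a))%:~R); rewrite norm distrC tab.
by rewrite /folded_coord !hK ha hb setUC.
Qed.

(** The values on the two sides coincide if both sets of pairs are inhabited.
    A nonzero value on one side forces the other set to be inhabited, and an
    empty set counts as 0. *)
Lemma o_dist_charts w C L Om w' C' L' Om' k l t :
    chart w C L -> coordinates_of L Om -> chart w' C' L' -> coordinates_of L' Om' ->
  o_dist w Om k l t = o_dist w' Om' k l t.
Proof.
move=> ch co ch' co'; rewrite /o_dist.
set S := mkset _; set S' := mkset _.
have const (u v : seq nat) (Cu Cv : pred label) (Lu Lv : root -> label)
    (Omu Omv : root -> nat * rat) p q :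
    chart u Cu Lu -> coordinates_of Lu Omu -> chart v Cv Lv -> coordinates_of Lv Omv ->
    Phi_set u Omu k l t p -> Phi_set v Omv k l t q ->
    gdist u (pair_seq p.1 p.2) = gdist v (pair_seq q.1 q.2).
  move=> cu ou cv ov /(Phi_related cu ou) [a [b [rab ->]]].
  move=> /(Phi_related cv ov) [a' [b' [rab' ->]]].
  exact: gdist_related cu cv rab rab'.
have fill (u v : seq nat) (Cu Cv : pred label) (Lu Lv : root -> label)
    (Omu Omv : root -> nat * rat) p :
    chart u Cu Lu -> coordinates_of Lu Omu -> chart v Cv Lv -> coordinates_of Lv Omv ->
    Phi_set u Omu k l t p -> gdist u (pair_seq p.1 p.2) <> 0%N ->
    exists q, Phi_set v Omv k l t q.
  move=> cu ou cv ov /(Phi_related cu ou) [a [b [rab ->]]] g0.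
  have [ab tab _] := rab; have := nonsimple_short cu ab g0; rewrite tab => ht.
  have [a' [b' rab']] := related_exists cv (chart_valid cu a) (chart_valid cu b) rab ht.
  by exists (a', b'); apply: related_Phi cv ov rab'.
have half (u v : seq nat) (Cu Cv : pred label) (Lu Lv : root -> label)
    (Omu Omv : root -> nat * rat) :
    chart u Cu Lu -> coordinates_of Lu Omu -> chart v Cv Lv -> coordinates_of Lv Omv ->
    forall d, (exists2 p, Phi_set u Omu k l t p & gdist u (pair_seq p.1 p.2) = d) ->
    d <> 0%N -> exists2 q, Phi_set v Omv k l t q & gdist v (pair_seq q.1 q.2) = d.
  move=> cu ou cv ov d [p hp <-] d0.
  have [q hq] := fill _ _ _ _ _ _ _ _ p cu ou cv ov hp d0.
  by exists q => //; rewrite (const _ _ _ _ _ _ _ _ p q cu ou cv ov hp hq).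
have pick (T : set nat) : xget 0%N T <> 0%N -> T (xget 0%N T).
  move=> h; apply: xgetPex; apply: contrapT => no; apply: h; apply: xgetPN => d Td.
  by apply: no; exists d.
case: (xget 0%N S =P 0%N) => [E|ne].
  rewrite E; case: (xget 0%N S' =P 0%N) => [->//|ne'].
  have hS := half _ _ _ _ _ _ _ _ ch' co' ch co _ (pick _ ne') ne'.
  have [p hp hd] : S (xget 0%N S) by apply: xgetPex; exists (xget 0%N S').
  have [q hq <-] := pick _ ne'.
  by rewrite -E -hd; apply: const ch co ch' co' hp hq.
have hS' := half _ _ _ _ _ _ _ _ ch co ch' co' _ (pick _ ne) ne.
have [q hq hd] : S' (xget 0%N S') by apply: xgetPex; exists (xget 0%N S).
have [p hp <-] := pick _ ne.
by rewrite -hd; apply: const ch co ch' co' hp hq.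
Qed.

Lemma folded_dist_poly_charts w C L Om w' C' L' Om' k l :
    chart w C L -> coordinates_of L Om -> chart w' C' L' -> coordinates_of L' Om' ->
  folded_dist_poly w Om k l = folded_dist_poly w' Om' k l.
Proof.
move=> ch co ch' co'; apply: eq_fsbigr => t _.
by rewrite (o_dist_charts k l t ch co ch' co').
Qed.
End Invariance.

(** * Commutation moves on words of crossings *)

Section CommutationMoves.
Implicit Types u v w : seq nat.

Lemma map_split (T : Type) (f : T -> nat) (s : seq T) u i j v :
  map f s = u ++ i :: j :: v ->
  exists s1 x y s2, [/\ s = s1 ++ x :: y :: s2, map f s1 = u, f x = i, f y = j & map f s2 = v].
Proof.
elim: u s => [|k u IH] [|x s] //=; first by case: s => //= y s [<- <- <-]; exists [::], x, y, s.
by case=> <- /IH [s1 [y [z [s2 [-> <- <- <- <-]]]]]; exists (x :: s1), y, z, s2.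
Qed.
End CommutationMoves.

Section WeylWords.
Variable r : nat.
Local Notation s_ := (simple_refl r).

Lemma weyl_elt_cat u v : weyl_elt r (u ++ v) = (weyl_elt r v * weyl_elt r u)%g.
Proof. by rewrite /weyl_elt rev_cat big_cat. Qed.

Lemma weyl_elt1 i : weyl_elt r [:: i] = s_ i.
Proof. by rewrite /weyl_elt /rev /= big_seq1. Qed.

Lemma weyl_elt_cons i w : weyl_elt r (i :: w) = (weyl_elt r w * s_ i)%g.
Proof. by rewrite -cat1s weyl_elt_cat weyl_elt1. Qed.

Lemma simple_reflK i : (s_ i * s_ i = 1)%g.
Proof. exact: tperm2. Qed.

Lemma inord_eq p q : (p <= r)%N -> (q <= r)%N -> (inord p == inord q :> 'I_r.+1) = (p == q).
Proof. by move=> hp hq; rewrite -val_eqE /= !inordK. Qed.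

Lemma simple_refl_far i j : (0 < i <= r)%N -> (j <= r)%N -> (j != i.-1) -> (j != i) ->
  s_ i (inord j) = inord j.
Proof.
by move=> hi hj h1 h2; rewrite /simple_refl tpermD // inord_eq // 1?eq_sym //; lia.
Qed.

Lemma simple_refl_comm i j : (0 < i <= r)%N -> (0 < j <= r)%N ->
  (i.+2 <= j)%N || (j.+2 <= i)%N -> (s_ i * s_ j = s_ j * s_ i)%g.
Proof.
move=> hi hj far; rewrite conjgC; congr (_ * _)%g.
by rewrite {1}/simple_refl tpermJ !simple_refl_far //; lia.
Qed.

Lemma longest_eltE j : (j <= r)%N -> longest_elt r (inord j) = inord (r - j).
Proof.
by move=> hj; rewrite /longest_elt permE; apply/val_inj; rewrite /= !inordK //; lia.
Qed.

Lemma longest_simple i : (0 < i <= r)%N ->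
  (s_ (r.+1 - i) * longest_elt r = longest_elt r * s_ i)%g.
Proof.
move=> hi; rewrite conjgC; congr (_ * _)%g.
rewrite /simple_refl tpermJ !longest_eltE; try lia.
by rewrite tpermC; congr tperm; congr inord; lia.
Qed.
End WeylWords.

Section Windows.
Variable n : nat.
Implicit Types (C : pred label) (s : seq label).
Local Notation valid := (valid n).
Local Notation prev := (prev n).
Local Notation residue := (residue n).
Local Notation s_ := (simple_refl n.*2.+1).
Local Notation coord := 'I_n.*2.+2.

(** A word of crossings is sorted for this relation if it is a linear
    extension. *)
Definition later_not_below : rel label := fun x y => ~~ label_le y x.

(** Each pair of wires crosses exactly once in a window: the cut C and its
    translate under next enclose one crossing per pair. *)
Record window s C : Prop := Window {
  window_cut : lower_cut n C;
  window_valid : forall z, z \in s -> valid z;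
  window_mem : forall z, valid z -> (z \in s) = ~~ C z && C (prev z);
  window_sorted : pairwise later_not_below s }.

Lemma window_uniq s C : window s C -> uniq s.
Proof.
move=> W; have := window_sorted W; elim: s {W} => //= x s IH /andP [/allP h /IH ->].
by rewrite andbT; apply/negP => /h; rewrite /later_not_below label_le_refl.
Qed.

Definition far i j := (i.+2 <= j)%N || (j.+2 <= i)%N.

(** If the two letters were ordered, the window would contain a crossing
    between them, and this would have to be listed between them. *)
Lemma window_swap s1 x y s2 C : window (s1 ++ x :: y :: s2) C ->
  far (residue x) (residue y) -> window (s1 ++ y :: x :: s2) C.
Proof.
move=> W hf; have U := window_uniq W; case: W => cut V M S.
have vx : valid x by apply: V; rewrite mem_cat !inE eqxx orbT.
have vy : valid y by apply: V; rewrite mem_cat !inE eqxx !orbT.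
have perm : perm_eq (s1 ++ y :: x :: s2) (s1 ++ x :: y :: s2).
  by rewrite perm_cat2l (perm_catCA [:: y] [:: x]).
split=> //; try by move=> z; rewrite (perm_mem perm); auto.
suff nxy : ~~ label_le x y.
  have E : y :: x :: s2 =i x :: y :: s2.
    by move=> z; rewrite !inE orbCA.
  move: S; rewrite !pairwise_cat (eq_allrel_memr _ s1 E) /=.
  case/and3P=> -> -> /and3P [/andP [_ h2] h3 ->].
  by rewrite h2 h3 {1}/later_not_below nxy.
apply/negP => xy.
have ne : x != y.
  by move: U; rewrite cat_uniq => /and3P [_ _ /= /andP []]; rewrite inE negb_or => /andP [].
have [z vz /andP [xz zy]] : exists2 z, valid z & label_lt x z && label_lt z y.
  by apply: (far_between vx vy) => //; rewrite /label_lt ne.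
have /andP [_ lxz] := xz; have /andP [_ lzy] := zy.
have : z \in s1 ++ x :: y :: s2.
  have xs : x \in s1 ++ x :: y :: s2 by rewrite mem_cat !inE eqxx orbT.
  have ys : y \in s1 ++ x :: y :: s2 by rewrite mem_cat !inE eqxx !orbT.
  move: xs ys; rewrite !M // => /andP [nCx _] /andP [_ Cy]; apply/andP; split.
    by apply: contra nCx; apply: (cut_down cut).
  by apply: (cut_down cut) Cy; rewrite ?valid_prev ?label_le_prev.
move: S; rewrite pairwise_cat /= => /and3P [/allrelP h1 _ /and3P [_ /allP h3 _]].
rewrite mem_cat !inE => /or4P [zs1|/eqP E|/eqP E|zs2].
- by have := h1 z x zs1 (mem_head _ _); rewrite /later_not_below lxz.
- by move: xz; rewrite E label_lt_irr.
- by move: zy; rewrite E label_lt_irr.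
- by have := h3 z zs2; rewrite /later_not_below lzy.
Qed.

(** Here u is the Weyl group element of the letters already read, and sigma
    places the wires at their initial heights. The condition says that the
    wires which meet at the letter z are those named by z, with the lower one
    first. *)
Fixpoint rooted (sigma : int -> coord) (u : 'S_n.*2.+2) s : Prop :=
  if s is z :: s' then
    [/\ u (inord (residue z).-1) = sigma z.1, u (inord (residue z)) = sigma z.2
      & rooted sigma (s_ (residue z) * u)%g s']
  else True.

Local Notation weyl s := (weyl_elt n.*2.+1 (map residue s)).

Lemma rooted_cat sigma u s1 s2 :
  rooted sigma u (s1 ++ s2) <-> rooted sigma u s1 /\ rooted sigma (weyl s1 * u)%g s2.
Proof.
elim: s1 u => [|z s1 IH] u /=.
  by rewrite /weyl_elt big_nil mul1g; tauto.
have -> : weyl (z :: s1) = (weyl s1 * s_ (residue z))%g.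
  exact: weyl_elt_cons.
rewrite -mulgA; split=> [[h1 h2 /IH [h3 h4]]|[[h1 h2 h3] h4]]; first by split.
by split=> //; apply/IH.
Qed.

Lemma rooted_mul sigma u (t : 'S_n.*2.+2) s : rooted sigma u s -> rooted (fun p => t (sigma p : coord)) (u * t)%g s.
Proof.
elim: s u => //= z s IH u [h1 h2 /IH h3]; rewrite !permM h1 h2; split=> //.
by rewrite mulgA.
Qed.

Lemma rooted_swap sigma u s1 x y s2 : valid x -> valid y -> far (residue x) (residue y) ->
  rooted sigma u (s1 ++ x :: y :: s2) -> rooted sigma u (s1 ++ y :: x :: s2).
Proof.
move=> /residue_bound bx /residue_bound bY hf.
rewrite !rooted_cat /= => -[h0 [h1 h2 [h3 h4 h5]]]; split=> //.
rewrite /far in hf.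
have ex k : (k <= n.*2.+1)%N -> k != (residue x).-1 -> k != residue x ->
    (s_ (residue x) * (weyl s1 * u))%g (inord k) = (weyl s1 * u)%g (inord k).
  by move=> *; rewrite permM simple_refl_far.
have ey k : (k <= n.*2.+1)%N -> k != (residue y).-1 -> k != residue y ->
    (s_ (residue y) * (weyl s1 * u))%g (inord k) = (weyl s1 * u)%g (inord k).
  by move=> *; rewrite permM simple_refl_far.
rewrite ex in h3; try lia.
rewrite ex in h4; try lia.
split=> //; split; rewrite ?ey //; try lia.
by rewrite mulgA simple_refl_comm // -mulgA.
Qed.

End Windows.

(** * Reflection functors slide the window *)

Section Diagrams.
Variable n : nat.
Local Notation coord := 'I_n.*2.+2.
Implicit Types (C : pred label) (s : seq label) (sigma : int -> coord).
Local Notation valid := (valid n).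
Local Notation next := (next n).
Local Notation prev := (prev n).
Local Notation residue := (residue n).
Local Notation same_wire := (same_wire n).
Local Notation s_ := (simple_refl n.*2.+1).
Local Notation weyl s := (weyl_elt n.*2.+1 (map residue s)).

(** A window together with initial heights sigma of the wires for which its
    word is a reduced word of the longest element whose root at z is
    eps_(sigma z.1) - eps_(sigma z.2). *)
Record diagram s C sigma : Prop := Diagram {
  diagram_window : window n s C;
  diagram_wire : forall p q, (sigma p == sigma q) = same_wire p q;
  diagram_onto : forall i, exists p, sigma p = i;
  diagram_rooted : rooted sigma 1%g s;
  diagram_pos : forall z, z \in s -> (sigma z.1 < sigma z.2)%N;
  diagram_longest : weyl s = longest_elt n.*2.+1;
  diagram_size : size s = (n.*2.+1 * n.+1)%N }.

Lemma diagram_swap s1 x y s2 C sigma : diagram (s1 ++ x :: y :: s2) C sigma ->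
  far (residue x) (residue y) -> diagram (s1 ++ y :: x :: s2) C sigma.
Proof.
move=> [W wire onto R P L S] hf; have W' := window_swap W hf.
have perm : perm_eq (s1 ++ y :: x :: s2) (s1 ++ x :: y :: s2).
  by rewrite perm_cat2l (perm_catCA [:: y] [:: x]).
have vx : valid x by apply: (window_valid W); rewrite mem_cat !inE eqxx orbT.
have vy : valid y by apply: (window_valid W); rewrite mem_cat !inE eqxx !orbT.
split=> //.
- exact: rooted_swap R.
- by move=> z; rewrite (perm_mem perm); apply: P.
- rewrite -L !map_cat !weyl_elt_cat /= !weyl_elt_cons -!mulgA; congr (_ * _)%g.
  by rewrite !mulgA simple_refl_comm ?residue_bound.
- by rewrite (perm_size perm).
Qed.

Lemma diagram_comm s C sigma w : diagram s C sigma -> comm_equiv (map residue s) w ->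
  exists2 s', w = map residue s' & diagram s' C sigma.
Proof.
move=> D h; move Ew: (map residue s) h => w0 h; elim: h Ew => [v|u v v' i j hf _ IH] Ew.
  by exists s.
have [s' /esym /map_split [s1 [x [y [s2 [E1 E2 E3 E4 E5]]]]] D'] := IH Ew.
subst; by exists (s1 ++ y :: x :: s2); rewrite ?map_cat //; apply: diagram_swap.
Qed.

(** A crossing is determined by its two wires, in this order, up to powers of
    next o next. *)
Lemma same_wires_shift x z : valid x -> valid z ->
    same_wire z.1 x.1 -> same_wire z.2 x.2 ->
  exists k : int, z.1 = x.1 + k * (4 * n + 2)%:Z /\ z.2 = x.2 + k * (4 * n + 2)%:Z.
Proof.
case: x z => [a b] [c d] /= vx vz h1 h2.
have e1 := same_wire_even h1; have e2 := same_wire_even h2.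
case: (boolP (even_int c)) => ec.
  have [k hk] := same_wire_evenP _ _ ec h1; exists k; split=> //.
  case: (boolP (even_int d)) => ed.
    have [k' hk'] := same_wire_evenP _ _ ed h2.
    suff : k' - k = 0 by move=> E; rewrite hk'; congr (_ + _ * _); lia.
    apply: (@small_multiple (4 * n + 2)%:Z _ ((d - c) - (b - a))).
      by rewrite hk hk'; ring.
    by move: vx vz; rewrite /valid /=; lia.
  by move: vx vz; rewrite /valid /even_int /= in ec ed e1 e2 *; lia.
have [[Ed Eb] ed] : (d = c + n.*2.+1%:Z /\ b = a + n.*2.+1%:Z) /\ even_int d.
  by move: vx vz; rewrite /valid /even_int /= in ec e1 e2 *; lia.
have [k hk] := same_wire_evenP _ _ ed h2; exists k; split=> //; lia.
Qed.

(** Distinct crossings of the same two wires in the same order are at least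
    two steps of next apart, and a window has room for one. *)
Lemma window_wire_inj s C x z : window n s C -> x \in s -> z \in s ->
  same_wire z.1 x.1 -> same_wire z.2 x.2 -> z = x.
Proof.
move=> W xs zs h1 h2; have vx := window_valid W xs; have vz := window_valid W zs.
have [k [k1 k2]] := same_wires_shift vx vz h1 h2.
have [cut _ M _] := W; move: xs zs; rewrite !M // => /andP [Cx Cpx] /andP [Cz Cpz].
have [k0|k0|k0] := ltgtP k 0.
- case/negP: Cz; apply: (cut_down cut) Cpx; rewrite ?valid_prev //.
  by move: vx vz; rewrite /valid /label_le /prev /= => *; rewrite k1 k2; nia.
- case/negP: Cx; apply: (cut_down cut) Cpz; rewrite ?valid_prev //.
  by move: vx vz; rewrite /valid /label_le /prev /= => *; rewrite k1 k2; nia.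
by case: x z k1 k2 {vx vz h1 h2 Cx Cpx Cz Cpz} => [a b] [c d] /= -> ->; rewrite k0 !mul0r !addr0.
Qed.

Lemma tperm_adjacent_lt i (a b : coord) : (0 < i <= n.*2.+1)%N -> (a < b)%N ->
  ~ (a = inord i.-1 /\ b = inord i) -> (s_ i a < s_ i b)%N.
Proof.
move=> hi ab ne.
rewrite /simple_refl; move: ne; set p := inord i.-1; set q := inord i => ne.
have E1 : nat_of_ord p = i.-1 by rewrite inordK //; lia.
have E2 : nat_of_ord q = i by rewrite inordK //; lia.
have ord_neq (c d : coord) : c <> d -> nat_of_ord c <> nat_of_ord d.
  by move=> cd /val_inj.
clearbody p q.
case: tpermP => [ea|ea|/ord_neq a1 /ord_neq a2];
case: tpermP => [eb|eb|/ord_neq b1 /ord_neq b2]; try (by case: ne); subst; lia.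
Qed.

Lemma cut_add C x : lower_cut n C -> (forall z, valid z -> label_lt z x -> C z) ->
  lower_cut n (predU1 x C).
Proof.
move=> [down [B hB]] hx; split.
  move=> y z vy vz yz /= /orP [/eqP E|Cz]; last by rewrite /= (down y z) ?orbT.
  by case: (eqVneq y x) => [->|ne]; rewrite /= ?eqxx // (hx y) ?orbT // /label_lt ne -E.
exists (`|B| + `|x.1| + 1) => z vz; have [h1 h2] := hB z vz; split=> hz.
  by rewrite /= h1 ?orbT //; lia.
rewrite /= negb_or h2 ?andbT; last by lia.
by apply/eqP => E; move: hz; rewrite E; lia.
Qed.

Lemma cut_remove C x : lower_cut n C -> (forall z, valid z -> label_lt x z -> ~~ C z) ->
  lower_cut n (predD1 C x).
Proof.
move=> [down [B hB]] hx; split.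
  move=> y z vy vz yz /= /andP [zx Cz]; rewrite /= (down y z) // andbT.
  apply: contraL Cz => /eqP E; apply: hx => //; rewrite /label_lt -E yz andbT.
  by rewrite E eq_sym.
exists (`|B| + `|x.1| + 1) => z vz; have [h1 h2] := hB z vz; split=> hz.
  rewrite /= h1 ?andbT; last by lia.
  by apply/eqP => E; move: hz; rewrite E; lia.
by rewrite /= negb_and h2 ?orbT //; lia.
Qed.

Lemma label_lt_next x : valid x -> label_lt x (next x).
Proof. by rewrite label_ltE /valid /label_le /next /time /= => v; lia. Qed.

(** Sliding the window over a minimal crossing x adds x to the cut. Nothing in
    the window lies above next x, since x would lie below its predecessor in
    C. *)
Lemma window_first x s C : window n (x :: s) C ->
  window n (rcons s (next x)) (predU1 x C).
Proof.
move=> W; have U := window_uniq W; case: W => cut V M S.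
have vx : valid x by apply: V; rewrite mem_head.
have /andP [Cx Cpx] : ~~ C x && C (prev x) by rewrite -M // mem_head.
move: S => /= /andP [/allP S1 S2].
have lowx z : valid z -> label_lt z x -> C z.
  move=> vz zx; apply: contraT => Cz; have /andP [zx' lzx] := zx.
  have : z \in x :: s.
    rewrite M // Cz /=.
    by apply: (cut_down cut) Cpx; rewrite ?valid_prev ?label_le_prev.
  by rewrite inE (negbTE zx') /= => /S1; rewrite /later_not_below lzx.
have cut' := cut_add cut lowx.
have xs : x \notin s by case/andP: U.
have nx : next x != x by have := label_lt_next vx; rewrite /label_lt eq_sym => /andP [].
have nCnx : ~~ C (next x).
  apply: contra Cx => h; apply: (cut_down cut) h; rewrite ?valid_next //.
  by case/andP: (label_lt_next vx).
split=> //.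
- move=> z; rewrite mem_rcons inE => /orP [/eqP ->|zs]; first by rewrite valid_next.
  by apply: V; rewrite inE zs orbT.
- move=> z vz; rewrite mem_rcons inE /= negb_or.
  have -> : (prev z == x) = (z == next x).
    by apply/eqP/eqP => [<-|->]; rewrite ?prevK ?nextK.
  case: (eqVneq z (next x)) => [->|znx] /=; first by rewrite nx nCnx.
  case: (eqVneq z x) => [->|zx] /=; first by rewrite (negbTE xs).
  by have := M z vz; rewrite inE (negbTE zx).
rewrite -cats1 pairwise_cat S2 /= andbT allrel1r; apply/allP => z zs.
rewrite /later_not_below; apply/negP => h.
have vz : valid z by apply: V; rewrite inE zs orbT.
have : C (prev z) by have := M z vz; rewrite inE zs orbT => /esym /andP [].
move=> h'; case/negP: Cx; apply: (cut_down cut) h'; rewrite ?valid_prev //.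
by rewrite -[x in label_le x _](nextK n x) label_le_prev.
Qed.

Lemma window_last x s C : window n (rcons s x) C ->
  window n (prev x :: s) (predD1 C (prev x)).
Proof.
move=> W; have U := window_uniq W; case: W => cut V M S.
have vx : valid x by apply: V; rewrite mem_rcons mem_head.
have /andP [Cx Cpx] : ~~ C x && C (prev x) by rewrite -M // mem_rcons mem_head.
move: S; rewrite -cats1 pairwise_cat allrel1r /= andbT => /andP [/allP S1 S2].
have vpx : valid (prev x) by rewrite valid_prev.
have highx z : valid z -> label_lt (prev x) z -> ~~ C z.
  move=> vz pxz; apply/negP => Cz; have /andP [ne le] := pxz.
  have : next z \in rcons s x.
    rewrite M ?valid_next // nextK Cz andbT; apply: contra Cx.
    by apply: (cut_down cut); rewrite ?valid_next // -(label_le_prev n) nextK.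
  rewrite mem_rcons inE => /orP [/eqP E|/S1].
    by move: ne; rewrite -E nextK eqxx.
  by rewrite /later_not_below -(label_le_prev n) nextK le.
have cut' := cut_remove cut highx.
have xs : x \notin s by move: U; rewrite rcons_uniq => /andP [].
have pxx : label_lt (prev x) x by have := label_lt_next vpx; rewrite prevK.
have npx : prev x \notin s.
  apply/negP => h; have := M (prev x) vpx; rewrite mem_rcons inE h orbT Cpx //.
split=> //.
- move=> z; rewrite inE => /orP [/eqP ->//|zs].
  by apply: V; rewrite mem_rcons inE zs orbT.
- move=> z vz; rewrite inE /= negb_and negbK.
  rewrite (can_eq (@prevK n)).
  case: (eqVneq z (prev x)) => [E|zpx] /=.
    rewrite E; case/andP: pxx => -> _ /=.
    apply/esym; apply: (cut_down cut) Cpx; rewrite ?valid_prev ?label_le_prev //.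
    by have := label_lt_next vpx; rewrite prevK => /andP [].
  case: (eqVneq z x) => [->|zx] /=; first by rewrite (negbTE xs) andbF.
  by have := M z vz; rewrite mem_rcons inE (negbTE zx).
rewrite /= S2 andbT; apply/allP => z zs; rewrite /later_not_below.
have vz : valid z by apply: V; rewrite mem_rcons inE zs orbT.
have /andP [Cz _] : ~~ C z && C (prev z) by rewrite -M // mem_rcons inE zs orbT.
by apply: contra Cz => h; apply: (cut_down cut) Cpx.
Qed.
End Diagrams.

Section Rotations.
Variable n : nat.
Local Notation coord := 'I_n.*2.+2.
Implicit Types (C : pred label) (s : seq label) (sigma : int -> coord).
Local Notation valid := (valid n).
Local Notation next := (next n).
Local Notation prev := (prev n).
Local Notation residue := (residue n).
Local Notation s_ := (simple_refl n.*2.+1).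
Local Notation weyl s := (weyl_elt n.*2.+1 (map residue s)).

Lemma diagram_next_wire s C sigma x : diagram s C sigma ->
  sigma (next x).1 = sigma x.2 /\ sigma (next x).2 = sigma x.1.
Proof.
move=> D; split=> //; apply/eqP; rewrite (diagram_wire D) /=.
by rewrite same_wire_sym -same_wire_period addrK same_wire_refl.
Qed.

Lemma diagram_prev_wire s C sigma x : diagram s C sigma ->
  sigma (prev x).1 = sigma x.2 /\ sigma (prev x).2 = sigma x.1.
Proof.
by move=> D; have [h1 h2] := diagram_next_wire (prev x) D; rewrite prevK in h1 h2.
Qed.

(** A simple reflection makes no positive root negative except its own, which
    belongs to x. *)
Lemma other_roots_stay_positive s C sigma x z i : diagram s C sigma -> x \in s -> z \in s -> z != x ->
    (0 < i <= n.*2.+1)%N -> sigma x.1 = inord i.-1 -> sigma x.2 = inord i ->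
  (s_ i (sigma z.1) < s_ i (sigma z.2))%N.
Proof.
move=> D xs zs ne hi h1 h2; apply: tperm_adjacent_lt => //; first exact: diagram_pos D _ zs.
case=> e1 e2; case/eqP: ne; apply: (window_wire_inj (diagram_window D) xs zs).
  by rewrite -(diagram_wire D) e1 h1.
by rewrite -(diagram_wire D) e2 h2.
Qed.

(** Deleting the first letter i changes the prefixes by s_i on the left, hence
    also the initial heights. The root of the appended letter comes out right
    because w_0 conjugates s_i into the reflection of star i. *)
Lemma diagram_first x s C sigma : diagram (x :: s) C sigma ->
  exists C' sigma', diagram (rcons s (next x)) C' sigma'.
Proof.
move=> D; have W := diagram_window D; have U := window_uniq W.
have vx : valid x by apply: (window_valid W); rewrite mem_head.
have bi := residue_bound vx; set i := residue x in bi *.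
have [h1 h2 h3] := diagram_rooted D; rewrite !perm1 in h1 h2.
have [_ x2] := diagram_next_wire x D.
have Wl := diagram_longest D; rewrite /= weyl_elt_cons -/i in Wl.
have Es : weyl s = (longest_elt n.*2.+1 * s_ i)%g.
  by rewrite -Wl -mulgA simple_reflK mulg1.
exists (predU1 x C), (fun p => s_ i (sigma p)); split.
- exact: window_first W.
- by move=> p q; rewrite (inj_eq perm_inj) (diagram_wire D).
- move=> j; have [p hp] := diagram_onto D ((s_ i)^-1%g j); exists p.
  by rewrite hp permKV.
- rewrite -cats1 rooted_cat; split.
    have := rooted_mul (s_ i) h3; by rewrite mulg1 simple_reflK.
  rewrite /= mulg1 Es !permM residue_next // /star -/i !longest_eltE; try lia.
  have -> : (n.*2.+1 - (n.*2.+2 - i).-1 = i)%N by lia.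
  have -> : (n.*2.+1 - (n.*2.+2 - i) = i.-1)%N by lia.
  by rewrite x2 -h1 -h2.
- move=> z; rewrite mem_rcons inE => /orP [/eqP ->|zs].
    rewrite x2 -h1 -h2 /simple_refl tpermL tpermR !inordK //; lia.
  apply: (other_roots_stay_positive D (mem_head _ _) _ _ bi) => //; first by rewrite inE zs orbT.
  by apply/eqP => E; move: U; rewrite -E /= zs.
- rewrite -cats1 map_cat weyl_elt_cat Es /= weyl_elt1 residue_next // /star -/i.
  by rewrite mulgA longest_simple // -mulgA simple_reflK mulg1.
by have := diagram_size D; rewrite size_rcons.
Qed.

Lemma diagram_last x s C sigma : diagram (rcons s x) C sigma ->
  exists C' sigma', diagram (prev x :: s) C' sigma'.
Proof.
move=> D; have W := diagram_window D; have U := window_uniq W.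
have xs : x \in rcons s x by rewrite mem_rcons mem_head.
have vx : valid x by apply: (window_valid W).
have bi := residue_bound vx.
have [x1 x2] := diagram_prev_wire x D.
have vpx : valid (prev x) by rewrite valid_prev.
have Ei : residue x = star n (residue (prev x)) by rewrite -residue_next // prevK.
have bj := residue_bound vpx; set j := residue (prev x) in Ei bj *.
have := diagram_rooted D; rewrite -cats1 rooted_cat /= mulg1 => -[h3 [h1 h2 _]].
have Wl := diagram_longest D.
rewrite -cats1 map_cat weyl_elt_cat /= weyl_elt1 Ei in Wl.
have Es : weyl s = (s_ (star n j) * longest_elt n.*2.+1)%g.
  by rewrite -Wl mulgA simple_reflK mul1g.
have sx2 : sigma x.2 = inord j.
  rewrite -h2 Es Ei permM /simple_refl tpermR longest_eltE /star; last by lia.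
  by congr inord; lia.
have sx1 : sigma x.1 = inord j.-1.
  rewrite -h1 Es Ei permM /simple_refl tpermL longest_eltE /star; last by lia.
  by congr inord; lia.
exists (predD1 C (prev x)), (fun p => s_ j (sigma p)); split.
- exact: window_last W.
- by move=> p q; rewrite (inj_eq perm_inj) (diagram_wire D).
- move=> k; have [p hp] := diagram_onto D ((s_ j)^-1%g k); exists p.
  by rewrite hp permKV.
- split; rewrite ?perm1 ?x1 ?x2 -/j ?sx1 ?sx2 /simple_refl ?tpermL ?tpermR //.
  by have := rooted_mul (s_ j) h3; rewrite mul1g mulg1.
- move=> z; rewrite inE => /orP [/eqP ->|zs].
    rewrite x1 x2 sx1 sx2 /simple_refl tpermL tpermR !inordK //; lia.
  apply: (other_roots_stay_positive D xs _ _ bj) => //; first by rewrite mem_rcons inE zs orbT.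
  by apply/eqP => E; move: U; rewrite -E rcons_uniq zs.
- by rewrite /= weyl_elt_cons -/j Es -mulgA -longest_simple // -/(star n j) mulgA simple_reflK mul1g.
by have := diagram_size D; rewrite size_rcons.
Qed.

(** Commutation moves carried out on crossings rather than on letters, so that
    a chain of moves determines the crossings at its end, and not only their
    letters. *)
Inductive label_comm : seq label -> seq label -> Prop :=
| LabelRefl s : label_comm s s
| LabelSwap s s1 x y s2 : far (residue x) (residue y) ->
    label_comm s (s1 ++ x :: y :: s2) -> label_comm s (s1 ++ y :: x :: s2).

Lemma label_comm_trans s1 s2 s3 : label_comm s1 s2 -> label_comm s2 s3 -> label_comm s1 s3.
Proof. by move=> h12 h23; elim: h23 h12 => // s t x y t' hf _ IH /IH; apply: LabelSwap. Qed.

Lemma label_comm_cat t s1 s2 : label_comm s1 s2 -> label_comm (t ++ s1) (t ++ s2).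
Proof.
elim => [s|s s3 x y s4 hf _]; first exact: LabelRefl.
by rewrite !catA; apply: LabelSwap.
Qed.

Lemma label_comm_equiv s1 s2 : label_comm s1 s2 -> comm_equiv (map residue s1) (map residue s2).
Proof.
elim => [s|s s3 x y s4 hf _]; first exact: CommRefl.
by rewrite !map_cat; apply: CommSwap.
Qed.

Lemma label_comm_diagram s1 s2 C sigma :
  label_comm s1 s2 -> diagram s1 C sigma -> diagram s2 C sigma.
Proof. by move=> h D; elim: h D => // s s3 x y s4 hf _ IH /IH /diagram_swap; apply. Qed.

Lemma label_comm_move_past (x : label) (t r : seq label) :
    (forall y, y \in t -> far (residue x) (residue y)) ->
  label_comm (x :: t ++ r) (t ++ x :: r).
Proof.
elim: t => [|y t IH] h; first exact: LabelRefl.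
apply: (@label_comm_trans _ (y :: x :: t ++ r)).
  have fxy := h y (mem_head _ _).
  exact: (@LabelSwap _ [::] _ _ (t ++ r) fxy (LabelRefl _)).
apply: (@label_comm_cat [:: y]); apply: IH => z zt; apply: h.
by rewrite inE zt orbT.
Qed.

(** A lower set can be moved to the front: each letter it has to pass is
    incomparable with it and hence commutes with it. *)
Lemma label_comm_filter_front (s : seq label) (P : pred label) :
    (forall z, z \in s -> valid z) -> pairwise later_not_below s ->
    (forall x y, x \in s -> y \in s -> label_le x y -> P y -> P x) ->
  label_comm s (filter P s ++ filter (predC P) s).
Proof.
elim: s => [|x s IH] V S down; first exact: LabelRefl.
move: S => /= /andP [/allP S1 S2].
have {}IH : label_comm s (filter P s ++ filter (predC P) s).
  apply: IH => //; first by move=> z zs; apply: V; rewrite inE zs orbT.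
  by move=> y z ys zs; apply: down; rewrite inE ?ys ?zs orbT.
have IHx := @label_comm_cat [:: x] _ _ IH.
case: (boolP (P x)) => Px //=.
apply: label_comm_trans IHx _; apply: label_comm_move_past => y.
rewrite mem_filter => /andP [Py ys]; rewrite /far.
have ys' : y \in x :: s by rewrite inE ys orbT.
have nyx : ~~ label_le y x by apply: S1.
have nxy : ~~ label_le x y by apply: contra Px => h; apply: down h Py; rewrite ?mem_head.
have := @near_comparable n x y (V x (mem_head _ _)) (V y ys').
rewrite (negbTE nyx) (negbTE nxy) /= => h.
by apply: contraT => hn; apply: h; lia.
Qed.

End Rotations.

(** * A window determines the convex order and the weights *)

Section DiagramChart.
Variable n : nat.
Local Notation root := (posroot n).
Local Notation coord := 'I_n.*2.+2.
Implicit Types (C : pred label) (s : seq label) (sigma : int -> coord).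
Local Notation valid := (valid n).
Local Notation residue := (residue n).
Local Notation wires := (wires n).

Lemma card_posroot : #|{: root}| = (n.*2.+1 * n.+1)%N.
Proof.
rewrite card_sig -sum1_card.
have -> : (n.*2.+1 * n.+1 = 'C(n.*2.+2, 2))%N by rewrite bin2; lia.
rewrite -bin2_sum big_mkord.
rewrite -(pair_big_dep xpredT (fun i j : coord => i < j)%N (fun _ _ => 1%N)) /=.
rewrite (exchange_big_dep xpredT) //=; apply: eq_bigr => j _.
rewrite -(@big_ord_widen _ _ _ j n.*2.+2 (fun=> 1%N)) ?sum_nat_const ?card_ord ?muln1 //.
exact: ltnW.
Qed.

Definition root_of sigma (z : label) : root :=
  insubd (highest_root n) (sigma z.1, sigma z.2).

Lemma root_ofE s C sigma z : diagram s C sigma -> z \in s ->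
  val (root_of sigma z) = (sigma z.1, sigma z.2).
Proof. by move=> D zs; rewrite insubdK //; apply: (diagram_pos D). Qed.

Lemma beta_diagram s C sigma k : diagram s C sigma -> (k < size s)%N ->
  beta n (map residue s) k = root_of sigma (nth (0, 0) s k).
Proof.
move=> D ks; have := diagram_rooted D.
rewrite -{1}(cat_take_drop k s) (drop_nth (0, 0)) // rooted_cat mulg1 /= => -[_ [h1 h2 _]].
by rewrite /beta -map_take (nth_map (0, 0)) // h1 h2.
Qed.

Lemma root_of_inj s C sigma : diagram s C sigma -> {in s &, injective (root_of sigma)}.
Proof.
move=> D x y xs ys /(congr1 val); rewrite !(root_ofE D) // => -[/eqP h1 /eqP h2].
by rewrite !(diagram_wire D) in h1 h2; apply: (window_wire_inj (diagram_window D)) h1 h2.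
Qed.

(** The letters of a window have distinct roots, and there are as many letters
    as positive roots. *)
Lemma root_of_onto s C sigma b : diagram s C sigma -> b \in map (root_of sigma) s.
Proof.
move=> D.
have U : uniq (map (root_of sigma) s).
  rewrite map_inj_in_uniq ?(window_uniq (diagram_window D)) //.
  exact: root_of_inj D.
have sz : (size (enum {: root}) <= size (map (root_of sigma) s))%N.
  by rewrite -cardE card_posroot size_map (diagram_size D).
have [_ ->] := uniq_min_size U (fun x _ => mem_enum {: root} x) sz.
by rewrite mem_enum.
Qed.

Definition label_of s sigma (b : root) : label :=
  nth (0, 0) s (index b (map (root_of sigma) s)).

Lemma label_of_mem s C sigma b : diagram s C sigma -> label_of s sigma b \in s.
Proof.
by move=> D; rewrite /label_of mem_nth // -(size_map (root_of sigma)) index_mem (root_of_onto b D).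
Qed.

Lemma label_ofK s C sigma : diagram s C sigma -> cancel (label_of s sigma) (root_of sigma).
Proof.
move=> D b; have hb := root_of_onto b D.
by rewrite /label_of -(nth_map _ b) ?nth_index // -(size_map (root_of sigma)) index_mem.
Qed.

Lemma root_ofK s C sigma : diagram s C sigma -> {in s, cancel (root_of sigma) (label_of s sigma)}.
Proof.
move=> D z zs; apply: (root_of_inj D) => //; first exact: label_of_mem D.
by rewrite (label_ofK D).
Qed.

Lemma diagram_mem s s' C sigma sigma' : diagram s C sigma -> diagram s' C sigma' -> s =i s'.
Proof.
move=> D D' z; case: (boolP (valid z)) => vz.
  by rewrite (window_mem (diagram_window D)) // (window_mem (diagram_window D')).
apply/idP/idP => h; case/negP: vz; first exact: (window_valid (diagram_window D) h).
exact: (window_valid (diagram_window D') h).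
Qed.

Lemma diagram_index_lt s C sigma x y : diagram s C sigma -> x \in s -> y \in s ->
  label_lt x y -> (index x s < index y s)%N.
Proof.
move=> D xs ys /andP [ne xy]; rewrite ltnNge; apply/negP; rewrite leq_eqVlt => /orP [/eqP E|h].
  by case/negP: ne; rewrite -(nth_index (0, 0) xs) -E nth_index.
have := window_sorted (diagram_window D) => /(pairwiseP (0, 0)) /(_ (index y s) (index x s)).
by rewrite !inE !index_mem !nth_index // /later_not_below xy => /(_ ys xs h).
Qed.

Lemma beta_index s s' C sigma b : diagram s C sigma -> diagram s' C sigma ->
  beta n (map residue s') (index (label_of s sigma b) s') = b.
Proof.
move=> D D'; have bs : label_of s sigma b \in s' by rewrite -(diagram_mem D D') (label_of_mem b D).
by rewrite (beta_diagram D') ?index_mem // nth_index // (label_ofK D).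
Qed.

Lemma index_beta s s' C sigma b k : diagram s C sigma -> diagram s' C sigma ->
  (k < size s')%N -> beta n (map residue s') k = b -> k = index (label_of s sigma b) s'.
Proof.
move=> D D' ks; rewrite (beta_diagram D') // => <-.
rewrite (root_ofK D) ?(diagram_mem D D') ?mem_nth // index_uniq //.
exact: window_uniq (diagram_window D').
Qed.

Lemma root_prec_index s s' C sigma a b : diagram s C sigma -> diagram s' C sigma ->
  (exists j k, [/\ (j < k < size s')%N, beta n (map residue s') j = a & beta n (map residue s') k = b])
  <-> (index (label_of s sigma a) s' < index (label_of s sigma b) s')%N.
Proof.
move=> D D'; split.
  case=> j [k [/andP [jk ks] ja kb]].
  by rewrite -(index_beta D D' _ ja) -?(index_beta D D' _ kb) //; apply: ltn_trans ks.
move=> h; exists (index (label_of s sigma a) s'), (index (label_of s sigma b) s').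
split; [|exact: (beta_index a D D')|exact: (beta_index b D D')].
apply/andP; split; first exact: h.
by rewrite index_mem -(diagram_mem D D') (label_of_mem b D).
Qed.

(** Bringing a lower set to the front is how linear extensions with prescribed
    first or last elements are produced below. *)
Lemma filter_front s C sigma (P : pred label) : diagram s C sigma ->
    (forall x y, x \in s -> y \in s -> label_le x y -> P y -> P x) ->
  let s' := filter P s ++ filter (predC P) s in
  diagram s' C sigma /\ comm_equiv (map residue s) (map residue s').
Proof.
move=> D down /=.
have h : label_comm n s (filter P s ++ filter (predC P) s).
  apply: label_comm_filter_front => //; first exact: window_valid (diagram_window D).
  exact: window_sorted (diagram_window D).
by split; [apply: label_comm_diagram h D|apply: label_comm_equiv].
Qed.

(** If the crossing of a is not below that of b, the linear extension which
    lists first all crossings below that of b has b before a. *)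
Lemma diagram_root_prec s C sigma a b : diagram s C sigma ->
  root_prec (map residue s) a b <-> label_lt (label_of s sigma a) (label_of s sigma b).
Proof.
move=> D; have as_ := label_of_mem a D; have bs := label_of_mem b D; split; last first.
  move=> ab w /(diagram_comm D) [s' -> D']; rewrite size_map; apply/(root_prec_index _ _ D D').
  have M b0 : label_of s sigma b0 \in s' by rewrite -(diagram_mem D D') (label_of_mem b0 D).
  exact: (diagram_index_lt D' (M a) (M b) ab).
move=> h; apply: contraT => nlt; set x := label_of s sigma a in as_ nlt.
set y := label_of s sigma b in bs nlt.
pose P (z : label) := label_le z y.
have down u v : u \in s -> v \in s -> label_le u v -> P v -> P u.
  by move=> _ _; apply: label_le_trans.
have [D' c] := filter_front D down.
have := h _ c; rewrite size_map => /(root_prec_index _ _ D D'); rewrite -/x -/y !index_cat.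
case: (eqVneq x y) => [->|ne]; first by rewrite ltnn.
have nxy : ~~ label_le x y by move: nlt; rewrite /label_lt ne.
rewrite !mem_filter /P (negbTE nxy) label_le_refl bs /= => lt_.
have : (index y (filter P s) < size (filter P s))%N.
  by rewrite index_mem mem_filter /P label_le_refl bs.
by move=> h1; have := ltn_trans lt_ h1; rewrite ltnNge leq_addr.
Qed.

(** For a linear extension the first and the last disagreement are extremal.
    Conversely, to test a minimal disagreement z, list the crossings below z
    first; then the first disagreement is at z. To test a maximal one, list
    those above z last. *)
Lemma diagram_seq_prec s C sigma m' m : diagram s C sigma ->
  seq_prec (map residue s) m' m <->
  extremal_prec (relpre (label_of s sigma) label_lt) m' m.
Proof.
move=> D; pose L := label_of s sigma; split; last first.
  move=> [ne lo hi] w /(diagram_comm D) [s' -> D'].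
  have M b : L b \in s' by rewrite -(diagram_mem D D') (label_of_mem b D).
  pose Q k := (k < size s')%N &&
    (m' (beta n (map residue s') k) != m (beta n (map residue s') k)).
  have Qindex b : m' b != m b -> Q (index (L b) s').
    move=> hb; rewrite /Q index_mem -(diagram_mem D D') (label_of_mem b D).
    by rewrite (beta_index b D D').
  have exQ : exists k, Q k.
    apply: contrapT => no; apply: ne; apply/ffunP => b; apply/eqP; apply: contraT => hb.
    by case: no; exists (index (L b) s'); apply: Qindex.
  have [k Qk kmin] := ex_minnP exQ.
  have bnd i : Q i -> (i <= size s')%N by case/andP => /ltnW.
  have [t Qt tmax] := ex_maxnP exQ bnd.
  have idx i : Q i -> index (L (beta n (map residue s') i)) s' = i.
    by case/andP => hi' _; rewrite -(index_beta D D' hi' erefl).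
  exists k, t; rewrite size_map; split.
  - by rewrite kmin //; case/andP: Qt.
  - move=> i hi' out; apply/eqP; apply: contraT => hne.
    have Qi : Q i by rewrite /Q hi'.
    by case: out; rewrite ltnNge ?(kmin i) ?(tmax i).
  - apply: lo; first by case/andP: Qk.
    move=> y hy; apply/eqP; apply: contraT => hne.
    have := kmin _ (Qindex _ hne); rewrite leqNgt -{1}(idx _ Qk).
    by rewrite (diagram_index_lt D' (M _) (M _) hy).
  - apply: hi; first by case/andP: Qt.
    move=> y hy; apply/eqP; apply: contraT => hne.
    have := tmax _ (Qindex _ hne); rewrite leqNgt -{1}(idx _ Qt).
    by rewrite (diagram_index_lt D' (M _) (M _) hy).
move=> h; split.
- by have [k [t [_ _ h1 _]]] := h _ (CommRefl _) => E; rewrite E ltnn in h1.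
- move=> z hz zmin; pose P (l : label) := label_le l (L z).
  have [|D' c] := @filter_front s C sigma P D.
    by move=> x y _ _; apply: label_le_trans.
  have zs := label_of_mem z D.
  have [k [t [/andP [kt ts] out lk _]]] := h _ c; rewrite size_map in ts out.
  set s' := filter P s ++ _ in D' c ts out lk.
  have ks := leq_ltn_trans kt ts.
  have M b : L b \in s' by rewrite -(diagram_mem D D') (label_of_mem b D).
  have zs' := M z.
  suff Ek : k = index (L z) s' by move: lk; rewrite Ek (beta_index z D D').
  have [ik|ki|//] := ltngtP (index (L z) s') k.
    have := out (index (L z) s'); rewrite index_mem zs' (beta_index z D D') => E.
    by rewrite E ?eqxx // in hz; left.
  have zP : L z \in filter P s by rewrite mem_filter /P label_le_refl.
  have Ek := index_beta D D' ks erefl; set b := beta n _ k in lk Ek; clearbody b.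
  have : L b \in filter P s.
    have -> : L b = nth (0, 0) s' k.
      by rewrite {1}Ek; apply/esym/nth_index/M.
    have kP : (k < size (filter P s))%N.
      by apply: ltn_trans ki _; rewrite /s' index_cat zP index_mem.
    by rewrite /s' nth_cat kP mem_nth.
  rewrite mem_filter /P => /andP [bz _].
  have bz' : label_lt (L b) (L z).
    by rewrite /label_lt bz andbT; apply/eqP => E; move: ki; rewrite Ek -/L E ltnn.
  by exfalso; move: lk; rewrite (zmin b bz') ltnn.
- move=> z hz zmax; pose P (l : label) := ~~ label_le (L z) l.
  have [|D' c] := @filter_front s C sigma P D.
    by move=> x y _ _ xy; apply: contra => zx; apply: label_le_trans zx xy.
  have zs := label_of_mem z D.
  have [k [t [/andP [kt ts] out _ lt_]]] := h _ c; rewrite size_map in ts out.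
  set s' := filter P s ++ _ in D' c ts out lt_.
  have M b : L b \in s' by rewrite -(diagram_mem D D') (label_of_mem b D).
  have zs' := M z.
  suff Et : t = index (L z) s' by move: lt_; rewrite Et (beta_index z D D').
  have [ti|it|//] := ltngtP t (index (L z) s').
    have := out (index (L z) s'); rewrite index_mem zs' (beta_index z D D') => E.
    by rewrite E ?eqxx // in hz; right.
  have zP : L z \in filter P s = false by rewrite mem_filter /P label_le_refl.
  have Et := index_beta D D' ts erefl; set b := beta n _ t in lt_ Et; clearbody b.
  have : L b \in filter (predC P) s.
    have -> : L b = nth (0, 0) s' t.
      by rewrite {1}Et; apply/esym/nth_index/M.
    have Pt : (size (filter P s) <= t)%N.
      by apply: leq_trans (ltnW it); rewrite /s' index_cat zP leq_addr.
    rewrite /s' nth_cat ltnNge Pt /= mem_nth //.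
    by rewrite -(ltn_add2l (size (filter P s))) subnKC // -size_cat.
  rewrite mem_filter /P /= negbK => /andP [zb _].
  have zb' : label_lt (L z) (L b).
    by rewrite /label_lt zb andbT; apply/eqP => E; move: it; rewrite Et -/L E ltnn.
  by exfalso; move: lt_; rewrite (zmax b zb') ltnn.
Qed.

Lemma root_vecE (b : root) (q : coord) :
  root_vec b 0 q = (q == (val b).1)%:Z - (q == (val b).2)%:Z.
Proof. by rewrite !mxE eqxx /=; do 2!case: (q == _). Qed.

Lemma diagram_weight s C sigma m1 m2 : diagram s C sigma ->
  weight m1 = weight m2 <->
  forall j, \sum_b wires (label_of s sigma b) j *+ m1 b =
            \sum_b wires (label_of s sigma b) j *+ m2 b.
Proof.
move=> D.
have E m j : weight m 0 (sigma j) = \sum_b wires (label_of s sigma b) j *+ m b.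
  rewrite /weight summxE; apply: eq_bigr => b _; rewrite mulmxnE root_vecE.
  have -> : val b = (sigma (label_of s sigma b).1, sigma (label_of s sigma b).2).
    by rewrite -{1}(label_ofK D b) (root_ofE D) ?(label_of_mem b D).
  by rewrite /= !(diagram_wire D) /wires !(same_wire_sym n j).
split=> [h j|h]; first by rewrite -!E h.
apply/rowP => i; have [j <-] := diagram_onto D i; by rewrite !E.
Qed.

Lemma diagram_chart s C sigma : diagram s C sigma -> chart (map residue s) C (label_of s sigma).
Proof.
move=> D; have W := diagram_window D; split.
- exact: window_cut W.
- by move=> b; apply: (window_valid W); apply: label_of_mem D.
- exact: can_inj (label_ofK D).
- move=> b; rewrite -(window_mem W) ?(label_of_mem b D) //.
  by apply: (window_valid W); apply: label_of_mem D.
- move=> z vz Cz Cpz; exists (root_of sigma z); apply: (root_ofK D).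
  by rewrite (window_mem W) // Cz.
- by move=> a b; exact: (diagram_root_prec a b D).
- by move=> m' m; exact: (diagram_seq_prec m' m D).
by move=> m1 m2; exact: (diagram_weight m1 m2 D).
Qed.

End DiagramChart.

(** * Folded coordinates of a window *)

(** Reversals at other vertices do not touch the edge between i and j, so i is
    a sink of the original edge when it is first read. *)
Lemma adapted_first Q (v1 v2 : seq nat) i j :
  adapted Q (v1 ++ i :: v2) -> i \notin v1 -> j \notin v1 -> ~~ Q i j.
Proof.
elim: v1 Q => [|x v1 IH] Q /= [sink ad]; first by move=> _ _; apply: sink.
rewrite !inE !negb_or => /andP [ix iv] /andP [jx jv].
by have := IH _ ad iv jv; rewrite /reverse_at (negbTE ix) (negbTE jx).
Qed.

Section Coordinates.
Variable n : nat.
Local Notation coord := 'I_n.*2.+2.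
Local Notation valid := (valid n).
Local Notation next := (next n).
Local Notation prev := (prev n).
Local Notation residue := (residue n).

(** The letter after deletion of n+1 and renumbering. *)
Definition level (z : label) : nat := `|z.2 - z.1|%N./2.

Definition shift2 (z : label) : label := (z.1 - 2, z.2 - 2).

Lemma level_travelling u r : level (travelling u r) = r.
Proof. by rewrite /level /=; lia. Qed.

Lemma level_Pletter z : valid z -> residue z != n.+1 ->
  (if (n.+2 <= residue z)%N then (residue z).-1 else residue z) = level z.
Proof.
move=> vz rz; have [u [r [-> hr]]] := travellingP vz rz.
by rewrite residue_travelling level_travelling; case: ifP; lia.
Qed.

Lemma level_bound z : valid z -> residue z != n.+1 -> (0 < level z <= n.*2)%N.
Proof. by move=> vz rz; have [u [r [-> hr]]] := travellingP vz rz; rewrite level_travelling. Qed.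

Lemma level_residue x y : valid x -> valid y -> residue x != n.+1 -> residue y != n.+1 ->
  (level x == level y) = (residue x == residue y).
Proof.
move=> vx vy rx ry; have [u [r [-> hr]]] := travellingP vx rx.
have [v [q [-> hq]]] := travellingP vy ry.
by rewrite !level_travelling !residue_travelling; lia.
Qed.

Variables (s : seq label) (C : pred label) (sigma : int -> coord).
Hypothesis D : diagram s C sigma.
Let W := diagram_window D.

Lemma diagram_valid z : z \in s -> valid z.
Proof. exact: window_valid W _. Qed.

Lemma diagram_convex x y z : x \in s -> y \in s -> valid z -> label_le x z -> label_le z y -> z \in s.
Proof.
move=> xs ys vz xz zy; have vx := diagram_valid xs; have vy := diagram_valid ys.
move: xs ys; rewrite !(window_mem W) // => /andP [Cx _] /andP [_ Cy].
apply/andP; split; first by apply: contra Cx; apply: (cut_down (window_cut W)).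
by apply: (cut_down (window_cut W)) Cy; rewrite ?valid_prev ?label_le_prev.
Qed.

Lemma index_near_lt x y : x \in s -> y \in s -> (index x s < index y s)%N ->
  (residue x <= (residue y).+1)%N -> (residue y <= (residue x).+1)%N -> label_lt x y.
Proof.
move=> xs ys xy h1 h2; rewrite /label_lt.
have ne : x != y by apply/eqP => E; rewrite E ltnn in xy.
have := near_comparable (diagram_valid xs) (diagram_valid ys) h1 h2; rewrite ne.
case/orP => // yx; have := @diagram_index_lt n s C sigma y x D ys xs.
by rewrite /label_lt eq_sym ne yx => /(_ isT); lia.
Qed.

Definition rank_in (z : label) : nat :=
  count_mem (residue z) (take (index z s) (map residue s)).

(** Crossings with equal letters are totally ordered, so that the earlier ones
    are the smaller ones, whatever the linear extension. *)
Lemma rank_inE z : z \in s ->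
  rank_in z = count (fun y => (residue y == residue z) && label_lt y z) s.
Proof.
move=> zs; rewrite /rank_in -map_take count_map -[in RHS](cat_take_drop (index z s) s) count_cat.
have U := window_uniq W.
rewrite [X in _ = (_ + X)%N](_ : _ = 0%N) ?addn0.
  apply: eq_in_count => y yt /=; case: eqP => //= ry; apply/esym.
  have ys : y \in s by apply: mem_take yt.
  apply: index_near_lt => //; rewrite ?ry //.
  exact: index_ltn.
apply/eqP; rewrite -leqn0 leqNgt -has_count; apply/negP => /hasP [y yd /andP [_ yz]].
have ys : y \in s by apply: mem_drop yd.
have := diagram_index_lt D ys zs yz; rewrite -(in_take _ ys).
by move=> yt; move: U; rewrite -(cat_take_drop (index z s) s) cat_uniq =>
  /and3P [_ /hasP []]; exists y.
Qed.

Lemma rank_in_step z : z \in s -> residue z != n.+1 -> shift2 z \in s ->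
  rank_in z = (rank_in (shift2 z)).+1.
Proof.
move=> zs rz ys; rewrite !rank_inE //; set y := shift2 z in ys *.
have ry : residue y = residue z.
  by rewrite /y /residue /=; congr (_ + _)%N; [congr _./2|congr (nat_of_bool (_ < _)%N)]; lia.
have U := window_uniq W.
have := count_predUI (pred1 y) (fun x => (residue x == residue y) && label_lt x y) s.
rewrite [count (predI _ _) s](_ : _ = 0%N); last first.
  by apply/eqP; rewrite -leqn0 leqNgt -has_count; apply/hasP => -[x _ /= /andP [/eqP ->]];
     rewrite label_lt_irr andbF.
rewrite (count_uniq_mem _ U) ys addn0 add1n => <-; apply: eq_in_count => x xs /=.
have vx := diagram_valid xs; have vz := diagram_valid zs.
rewrite ry; case: (eqVneq (residue x) (residue z)) => [E|ne] /=; last first.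
  by rewrite orbF; apply/esym/negbTE/eqP => E; case/eqP: ne; rewrite E ry.
have rx : residue x != n.+1 by rewrite E.
move: E; rewrite !label_ltE /y; have [u [r [-> hr]]] := travellingP vx rx.
have [v [q [-> hq]]] := travellingP vz rz.
rewrite !residue_travelling -pair_eqE /pair_eq /label_le /time /= => E.
have -> : r = q by lia.
by lia.
Qed.

Lemma rank_in_first z : z \in s -> residue z != n.+1 -> shift2 z \notin s -> rank_in z = 0%N.
Proof.
move=> zs rz; rewrite rank_inE // => ys; apply/eqP; rewrite -leqn0 leqNgt -has_count.
apply: contra ys => /hasP [x xs /andP [/eqP rx xz]].
have vx := diagram_valid xs; have vz := diagram_valid zs.
have rx' : residue x != n.+1 by rewrite rx.
apply: (diagram_convex xs zs); move: rx xz; have [u [r [-> hr]]] := travellingP vx rx';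
  have [v [q [-> hq]]] := travellingP vz rz;
  rewrite !residue_travelling label_ltE /label_le /time /shift2 /= => E xz.
- by apply: (@valid_travelling _ _ _ (v - 1) q); lia.
- have F : r = q by lia.
  by rewrite F in xz *; lia.
by lia.
Qed.

Lemma first_lt x z : x \in s -> z \in s -> rank_in z = 0%N -> residue x = residue z ->
  ~~ label_lt x z.
Proof.
move=> xs zs; rewrite rank_inE // => /eqP h rx; apply/negP => xz.
by move: h; rewrite -leqn0 leqNgt -has_count; case/negP; apply/hasP; exists x; rewrite ?rx ?eqxx.
Qed.

(** The crossing just above x with the letter of y is already in the window,
    for it is enclosed between x and y. As y is the first with its letter, it
    is y. *)
Lemma first_neighbours x y : x \in s -> y \in s -> residue x != n.+1 -> residue y != n.+1 ->
    rank_in x = 0%N -> rank_in y = 0%N -> (index x s < index y s)%N ->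
    level y = (level x).+1 \/ level x = (level y).+1 ->
  time y = time x + 2.
Proof.
move=> xs ys rx ry fx fy xy hl; have vx := diagram_valid xs; have vy := diagram_valid ys.
have nyx : ~~ label_lt y x.
  by apply/negP => /(diagram_index_lt D ys xs); lia.
have [u [r [xE hr]]] := travellingP vx rx; have [v [q [yE hq]]] := travellingP vy ry.
rewrite xE yE !level_travelling in hl.
pose y0 := travelling (if q == r.+1 then u else u + 1) q.
have vy0 : valid y0 by apply: valid_travelling hq.
have ry0 : residue y0 = residue y by rewrite yE !residue_travelling.
have ty0 : time y0 = time x + 2.
  by rewrite xE /time /=; case: eqP => /=; lia.
have xy0 : label_le x y0.
  by rewrite xE /label_le /=; case: eqP => /=; lia.
suff : label_le y0 y.
  move=> y0y; have y0s : y0 \in s by apply: (diagram_convex xs ys).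
  have := first_lt y0s ys fy ry0; rewrite /label_lt y0y andbT negbK => /eqP <-.
  by [].
move: nyx; rewrite xE yE label_ltE /label_le /time /=.
by case: eqP => /=; lia.
Qed.

Variables (Q : rel nat) (xi : nat -> int).
Hypothesis dynkin : dynkin_quiver n.*2 Q.
Hypothesis adQ : adapted Q (Pword n (map residue s)).
Hypothesis height : height_function Q xi.

(** The first occurrence of the letter of x precedes all occurrences of the
    letter of y, so there is an arrow from y to x in Q. *)
Lemma first_height x y : x \in s -> y \in s -> residue x != n.+1 -> residue y != n.+1 ->
    rank_in x = 0%N -> rank_in y = 0%N -> (index x s < index y s)%N ->
    level y = (level x).+1 \/ level x = (level y).+1 ->
  xi (level x) = xi (level y) + 1.
Proof.
move=> xs ys rx ry fx fy xy hl; apply: height.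
have nQ : ~~ Q (level x) (level y).
  move: adQ; rewrite /Pword -{1}(cat_take_drop (index x s) s) (drop_nth (0, 0)) ?index_mem //.
  rewrite nth_index // map_cat filter_cat map_cat /= rx /=.
  rewrite level_Pletter ?diagram_valid //.
  have absent z : z \in s -> residue z != n.+1 -> rank_in z = 0%N ->
      (index x s <= index z s)%N ->
      level z \notin [seq (if (n.+2 <= j)%N then j.-1 else j) |
        j <- [seq residue i | i <- take (index x s) s] & j != n.+1].
    move=> zs rz fz xz; apply/mapP => -[j]; rewrite mem_filter => /andP [hj /mapP [u ut uE]] lz.
    have us : u \in s by apply: mem_take ut.
    rewrite uE in hj lz; rewrite level_Pletter ?diagram_valid // in lz.
    have ru : residue u = residue z by apply/eqP; rewrite -level_residue ?diagram_valid // lz.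
    have uz : (index u s < index z s)%N.
      by apply: leq_trans xz; apply: index_ltn.
    have := first_lt us zs fz ru.
    by rewrite index_near_lt // ru.
  by move/adapted_first; apply; apply: absent => //; apply: ltnW.
have [_ arrows] := dynkin.
have bx := level_bound (diagram_valid xs) rx; have bY := level_bound (diagram_valid ys) ry.
case: hl => hl.
  have := arrows (level x); rewrite hl in nQ *; rewrite (negbTE nQ) /= => h.
  by apply: h; lia.
have := arrows (level y); rewrite -hl (negbTE nQ) addbF => h.
by apply: h; lia.
Qed.

(** Twice the first coordinate prescribed for z plus the time of z. The claim
    that folded coordinates are a constant minus the time says that this does
    not depend on z. *)
Definition height_of z : int := 2 * (xi (level z) - (2 * rank_in z)%N%:Z) + time z.

(** Passing to the previous occurrence of the same letter lowers the time by 4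
    and the number of earlier occurrences by one. *)
Lemma height_of_first z : z \in s -> residue z != n.+1 ->
  exists x, [/\ x \in s, residue x != n.+1, level x = level z, rank_in x = 0%N
              & height_of x = height_of z].
Proof.
move Ek: (rank_in z) => k; elim: k z Ek => [|k IH] z Ek zs rz; first by exists z.
have ys : shift2 z \in s.
  by apply: contraT => h; rewrite rank_in_first in Ek.
have lz : level (shift2 z) = level z by rewrite /level /=; congr _./2; lia.
have ry : residue (shift2 z) != n.+1.
  by move: rz; rewrite /residue /= (_ : z.2 - 2 - (z.1 - 2) = z.2 - z.1) //; lia.
have Ey : rank_in (shift2 z) = k by move: Ek; rewrite rank_in_step // => -[].
have [x [xs rx lx fx hx]] := IH _ Ey ys ry; exists x; split=> //; rewrite ?lx ?lz // hx.
by rewrite /height_of lz Ek Ey /time /=; lia.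
Qed.

Lemma height_adjacent x y : x \in s -> y \in s -> residue x != n.+1 -> residue y != n.+1 ->
    rank_in x = 0%N -> rank_in y = 0%N -> level y = (level x).+1 ->
  height_of x = height_of y.
Proof.
move=> xs ys rx ry fx fy hl; rewrite /height_of fx fy.
have [xy|yx|E] := ltngtP (index x s) (index y s).
- rewrite (first_neighbours xs ys rx ry fx fy xy); auto.
  by rewrite (first_height xs ys rx ry fx fy xy); [lia|auto].
- rewrite (first_neighbours ys xs ry rx fy fx yx); auto.
  by rewrite (first_height ys xs ry rx fy fx yx); [lia|auto].
by move: hl; rewrite -(nth_index (0, 0) xs) E nth_index //; lia.
Qed.

(** On the orbit of crossings with the image letter under star there is a last
    one in C. The next crossing of its wires has the required letter and lies
    in the window. *)
Lemma level_occurs l : (0 < l <= n.*2)%N -> exists x, [/\ x \in s, residue x != n.+1 & level x = l].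
Proof.
move=> hl; have cut := window_cut W; have [B hB] := cut_bound cut.
pose u (k : nat) : label := (2 * k%:Z - 2 * `|B|, 2 * k%:Z - 2 * `|B| + (4 * n + 2)%:Z - 2 * l%:Z).
have vu k : valid (u k) by rewrite /u /valid /even_int /=; lia.
have ex : exists k, ~~ C (u k).
  exists (2 * `|B|)%N; have [_ h] := hB _ (vu (2 * `|B|)%N); apply: h; rewrite /u /=; lia.
have [k Ck kmin] := ex_minnP ex.
have k0 : (0 < k)%N.
  rewrite lt0n; apply/eqP => E; case/negP: Ck; have [h _] := hB _ (vu k); apply: h.
  by rewrite E /u /=; lia.
have Ck1 : C (u k.-1).
  by apply: contraT => /kmin; lia.
exists (next (u k.-1)); split.
- rewrite (window_mem W) ?valid_next // nextK Ck1 andbT; apply: contra Ck.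
  apply: (cut_down cut); rewrite ?valid_next //; rewrite /u /next /label_le /=; lia.
- by rewrite /u /next /residue /=; lia.
by rewrite /u /next /level /=; lia.
Qed.

Lemma height_of_const x y : x \in s -> y \in s -> residue x != n.+1 -> residue y != n.+1 ->
  height_of x = height_of y.
Proof.
have up l k u v : (0 < l)%N -> (l + k <= n.*2)%N -> u \in s -> v \in s ->
    residue u != n.+1 -> residue v != n.+1 -> level u = l -> level v = (l + k)%N ->
    rank_in u = 0%N -> rank_in v = 0%N ->
    height_of u = height_of v.
  move=> l0; elim: k v => [|k IH] v lk us vs ru rv lu lv fu fv.
    suff -> : u = v by [].
    rewrite addn0 in lv; have E : residue u = residue v.
      by apply/eqP; rewrite -level_residue ?diagram_valid // lu lv.
    have := first_lt us vs fv E; have := first_lt vs us fu (esym E).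
    rewrite /label_lt [v == u]eq_sym; case: (eqVneq u v) => //= ne h1 h2.
    have := @near_comparable n u v (diagram_valid us) (diagram_valid vs).
    by rewrite E (negbTE h1) (negbTE h2) => /(_ (leqnSn _) (leqnSn _)).
  have [|z' [zs' rz' lz']] := @level_occurs (l + k)%N; first by lia.
  have [z [zs rz lz fz _]] := height_of_first zs' rz'; rewrite lz' in lz.
  rewrite (IH z) //; last by lia.
  by apply: height_adjacent => //; lia.
move=> xs ys rx ry.
have [x' [xs' rx' lx' fx' <-]] := height_of_first xs rx.
have [y' [ys' ry' ly' fy' <-]] := height_of_first ys ry.
have bx := level_bound (diagram_valid xs') rx'; have bY := level_bound (diagram_valid ys') ry'.
case: (leqP (level x') (level y')) => h.
  by apply: (@up (level x') (level y' - level x')%N) => //; lia.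
by apply/esym/(@up (level y') (level x' - level y')%N) => //; lia.
Qed.

(** A crossing listed between x and y with one of their letters would be
    comparable with both, but no time is left between them. *)
Lemma arrow_cover x y : x \in s -> y \in s -> label_le x y -> time y = time x + 1 ->
    (residue x).+1 = residue y \/ (residue y).+1 = residue x ->
  arrow (map residue s) (index y s) (index x s).
Proof.
move=> xs ys xy txy hr.
have lxy : label_lt x y by rewrite label_ltE xy txy; lia.
have nthE z : z \in s -> nth 0%N (map residue s) (index z s) = residue z.
  by move=> zs; rewrite (nth_map (0, 0)) ?index_mem // nth_index.
have no t : (index x s < t < index y s)%N -> forall r, r = residue x \/ r = residue y ->
    nth 0%N (map residue s) t <> r.
  move=> /andP [xt ty] r hrr; have ts : (t < size s)%N by apply: ltn_trans ty _; rewrite index_mem.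
  rewrite (nth_map (0, 0)) // => E; set z := nth _ s t in E.
  have zs : z \in s by apply: mem_nth.
  have iz : index z s = t by rewrite index_uniq // (window_uniq W).
  have xz : label_lt x z by apply: index_near_lt; rewrite ?iz //; lia.
  have zy : label_lt z y by apply: index_near_lt; rewrite ?iz //; lia.
  by move: xz zy; rewrite !label_ltE txy; lia.
split.
- by rewrite !nthE //; lia.
- by rewrite size_map index_mem ys (diagram_index_lt D).
- by move=> t ht; rewrite nthE //; apply: no => //; left.
by move=> t ht; rewrite (nthE y) //; apply: no => //; right.
Qed.

(** The predecessor of the neighbour just after z lies below the neighbour
    just before z. Hence the window misses at most one of the two. *)
Lemma middle_neighbour z : (0 < n)%N -> z \in s -> residue z = n.+1 ->
  exists y, [/\ y \in s, residue y != n.+1 &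
    (label_le z y /\ time y = time z + 1 \/ label_le y z /\ time z = time y + 1) /\
    ((residue z).+1 = residue y \/ (residue y).+1 = residue z)].
Proof.
move=> n0 zs rz; have vz := diagram_valid zs; have cut := window_cut W.
pose y1 : label := if even_int z.1 then (z.1, z.2 - 1) else (z.1 - 1, z.2).
pose y2 : label := if even_int z.1 then (z.1, z.2 + 1) else (z.1 + 1, z.2).
have zE := middleP vz rz.
have [[v1 r1] [v2 r2]] : (valid y1 /\ (residue y1 = n \/ residue y1 = n.+2)) /\
    (valid y2 /\ (residue y2 = n \/ residue y2 = n.+2)).
  rewrite /y1 /y2 zE /=; move: z.1 => a; case: (boolP (even_int a)) => ea; rewrite /even_int in ea.
    split; split; [apply: (@valid_travelling _ _ _ (a %/ 2)%Z n)| |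
                   apply: (@valid_travelling _ _ _ (a %/ 2)%Z n.+1)|]; try lia;
      rewrite /residue /=; lia.
  split; split; [apply: (@valid_travelling _ _ _ ((a - 1) %/ 2)%Z n.+1)| |
                 apply: (@valid_travelling _ _ _ ((a + 1) %/ 2)%Z n)|]; try lia;
    rewrite /residue /=; lia.
have [t1 t2] : label_le y1 z /\ label_le z y2.
  by rewrite /y1 /y2; case: ifP => _; rewrite /label_le /=; lia.
have [t1' t2'] : time z = time y1 + 1 /\ time y2 = time z + 1.
  by rewrite /y1 /y2; case: ifP => _; rewrite /time /=; lia.
have p21 : label_le (prev y2) y1.
  rewrite /y1 /y2 /prev zE /label_le /=.
  by case: ifP => _ /=; clear - n0; lia.
have /andP [Cz Cpz] : ~~ C z && C (prev z) by rewrite -(window_mem W).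
case: (boolP (y2 \in s)) => h2; first exists y2.
  split=> //; first by case: r2 => ->; clear; lia.
  by split; [left|rewrite rz; case: r2 => ->; [right|left]].
exists y1; split; first last.
- by split; [right|rewrite rz; case: r1 => ->; [right|left]].
- by case: r1 => ->; clear; lia.
have C2 : ~~ C y2 by apply: contra Cz; apply: (cut_down cut).
rewrite (window_mem W) //; apply/andP; split.
  apply: contra h2 => C1; rewrite (window_mem W) // C2 /=.
  by apply: (cut_down cut) C1; rewrite ?valid_prev.
by apply: (cut_down cut) Cpz; rewrite ?valid_prev ?label_le_prev.
Qed.
End Coordinates.

Lemma diagram_coordinates n s C sigma Om : (0 < n)%N -> @diagram n s C sigma ->
  is_coordinate (map (residue n) s) Om -> coordinates_of (label_of s sigma) Om.
Proof.
move=> n0 D [Q [xi [dyn _ ad ht hOm]]].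
have [x0 [x0s rx0 _]] : exists x, [/\ x \in s, residue n x != n.+1 & level x = 1%N].
  by apply: (level_occurs D); lia.
pose h := height_of n s xi.
have hc z : z \in s -> residue n z != n.+1 -> h z = h x0.
  by move=> zs rz; apply: (height_of_const D dyn ad ht).
have OmE z : z \in s -> residue n z != n.+1 ->
  Om (root_of sigma z) = (residue n z, (xi (level z) - (2 * rank_in n s z)%N%:Z)%:~R).
  move=> zs rz; have zk : (index z s < size s)%N by rewrite index_mem.
  have := hOm (index z s); rewrite size_map zk => /(_ isT).
  rewrite (beta_diagram D) // (nth_map (0, 0)) // nth_index // => -[lo hi _ _].
  rewrite -(level_Pletter (diagram_valid D zs) rz).
  case: ifP => hr; first by rewrite hi.
  by rewrite lo //; lia.
exists (h x0)%:~R => b; set z := label_of s sigma b.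
have zs : z \in s := label_of_mem b D.
have zk : (index z s < size s)%N by rewrite index_mem.
rewrite -[in Om b](label_ofK D b) -/z /fold_coord /fresidue.
case: (eqVneq (residue n z) n.+1) => [rz|rz]; last first.
  rewrite OmE //= -(hc z zs rz) /h /height_of; congr pair.
  by rewrite -rmorphB /= -[2]/(2%:~R) -rmorphM /=; congr (_%:~R); lia.
have [y [ys ry [hy adj]]] := middle_neighbour D n0 zs rz.
have yk : (index y s < size s)%N by rewrite index_mem.
have := hOm (index z s); rewrite size_map zk => /(_ isT).
rewrite (beta_diagram D) // (nth_map (0, 0)) // nth_index // => -[_ _ later earlier].
have yE : 2 * (Om (root_of sigma y)).2 = (h x0)%:~R - (time y)%:~R.
  rewrite OmE //= -(hc y ys ry) /h /height_of.
  by rewrite -rmorphB /= -[2]/(2%:~R) -rmorphM /=; congr (_%:~R); lia.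
case: hy => -[le t].
  have ar := arrow_cover D zs ys le t adj.
  rewrite (later rz _ ar) (beta_diagram D) // nth_index // rz /=; congr pair.
  by rewrite mulrDr yE t rmorphD /= mulfV //; ring.
have ar : arrow (map (residue n) s) (index z s) (index y s).
  by apply: (arrow_cover D ys zs le t); tauto.
rewrite (earlier rz _ ar) (beta_diagram D) // nth_index // rz /=; congr pair.
by rewrite mulrBr yE t rmorphD /= mulfV //; ring.
Qed.

(** * The base word and its reflections *)

Section Base.
Variable n : nat.
Local Notation coord := 'I_n.*2.+2.
Local Notation valid := (valid n).
Local Notation prev := (prev n).
Local Notation residue := (residue n).
Local Notation same_wire := (same_wire n).
Local Notation weyl s := (weyl_elt n.*2.+1 (map residue s)).

(** The letter n+1 is crossed in the middle of the strip, after an odd number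
    of half-steps, which explains the minimum. *)
Definition gap (i : nat) : int := (minn i.*2 n.*2.+1)%:Z.

(** In an even block the wire named kap rises across all others in its way; in
    an odd block the wire named kap + 2n+1 falls. *)
Definition block_label (kap i : nat) : label :=
  if odd kap then (kap%:Z - n.*2.+1%:Z + gap i, kap%:Z + n.*2.+1%:Z)
  else (kap%:Z, kap%:Z + gap i).

Definition part_block kap j : seq label := [seq block_label kap i | i <- iota 1 j].
Definition blocks K : seq label := flatten [seq part_block kap n.+1 | kap <- iota 0 K].

Definition base_cut : pred label := fun z => (z.1 < 0) && (z.2 < n.*2.+1%:Z).

Lemma blocksS K : blocks K.+1 = blocks K ++ part_block K n.+1.
Proof. by rewrite /blocks -[K.+1]addn1 iotaD map_cat flatten_cat /= cats0. Qed.

Lemma part_blockS kap j : part_block kap j.+1 = rcons (part_block kap j) (block_label kap j.+1).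
Proof. by rewrite /part_block -[j.+1]addn1 iotaD map_cat /= cats1 add1n addn1. Qed.

Lemma valid_block_label kap i : (0 < i <= n.+1)%N -> valid (block_label kap i).
Proof. by rewrite /block_label /gap; case: ifP => h hi; rewrite /valid /even_int /=; lia. Qed.

Lemma residue_block_label kap i : (0 < i <= n.+1)%N ->
  residue (block_label kap i) = if odd kap then (n.*2.+2 - i)%N else i.
Proof. by rewrite /block_label /gap; case: ifP => h hi; rewrite /residue /=; lia. Qed.

Lemma iter_star kap i : (i <= n.*2.+2)%N ->
  iter kap (star n) i = if odd kap then (n.*2.+2 - i)%N else i.
Proof. by move=> hi; elim: kap => //= k ->; rewrite /star; case: (odd k) => /=; lia. Qed.

Lemma blocks_base : map residue (blocks n.*2.+1) = twisted_base n.
Proof.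
rewrite /blocks /twisted_base map_flatten -map_comp; congr flatten; apply: eq_map => k.
rewrite -[LHS]/(map residue (map (block_label k) _)) -map_comp; apply/eq_in_map => i; rewrite mem_iota => hi.
by rewrite /= residue_block_label ?iter_star //; lia.
Qed.

Lemma mem_blocks K z : z \in blocks K ->
  exists kap i, [/\ (kap < K)%N, (0 < i <= n.+1)%N & z = block_label kap i].
Proof.
case/flattenP => t /mapP [kap]; rewrite mem_iota => hk -> /mapP [i]; rewrite mem_iota => hi ->.
by exists kap, i; split=> //; lia.
Qed.

Lemma blocks_mem K kap i : (kap < K)%N -> (0 < i <= n.+1)%N -> block_label kap i \in blocks K.
Proof.
move=> hk hi; apply/flattenP; exists (part_block kap n.+1).
  by apply/mapP; exists kap; rewrite ?mem_iota.
by apply/mapP; exists i; rewrite ?mem_iota //; lia.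
Qed.

Lemma part_block_sorted kap j : (j <= n.+1)%N -> pairwise later_not_below (part_block kap j).
Proof.
elim: j => // j IH hj; rewrite part_blockS -cats1 pairwise_cat IH ?(ltnW hj) //= !andbT.
rewrite allrel1r; apply/allP => _ /mapP [i hi ->]; move: hi; rewrite mem_iota => hi.
by rewrite /later_not_below /block_label /gap; case: ifP => _; rewrite /label_le /=; lia.
Qed.

Lemma blocks_sorted K : pairwise later_not_below (blocks K).
Proof.
elim: K => // K IH; rewrite blocksS pairwise_cat IH part_block_sorted //= !andbT.
apply/allrelP => z y /mem_blocks [kap [i [hk hi ->]]] /mapP [j]; rewrite mem_iota => hj ->.
rewrite /later_not_below /block_label /gap.
by case: ifP => h1; case: ifP => h2; rewrite /label_le /=; lia.
Qed.

Lemma base_window : window n (blocks n.*2.+1) base_cut.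
Proof.
split; last exact: blocks_sorted.
- split; first by move=> [a b] [c d] _ _; rewrite /label_le /base_cut /=; lia.
  exists (4 * n + 2)%:Z => -[a b]; rewrite /valid /base_cut /=; lia.
- by move=> z /mem_blocks [kap [i [_ hi ->]]]; apply: valid_block_label.
move=> z vz; apply/idP/idP => [/mem_blocks [kap [i [hk hi ->]]]|].
  rewrite /block_label /gap /base_cut /prev.
  by case: ifP => hodd /=; lia.
case: z vz => a b; rewrite /base_cut /prev /= => vz hz.
pose kap := `|(Num.max a (b - n.*2.+1%:Z))%R|%N.
pose i := uphalf (minn `|b - a|%N (4 * n + 2 - `|b - a|)%N).
have bnd : 0 < b - a < (4 * n + 2)%:Z by move: vz; rewrite /valid /=; lia.
have hk : (kap < n.*2.+1)%N by rewrite /kap; lia.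
have hi : (0 < i <= n.+1)%N by rewrite /i; lia.
suff -> : (a, b) = block_label kap i by apply: blocks_mem.
move: vz; rewrite /valid /block_label /gap /even_int /= => vz.
by case: ifP => ok; congr pair; rewrite /kap /i in ok *; lia.
Qed.

Lemma size_blocks K : size (blocks K) = (K * n.+1)%N.
Proof.
by elim: K => // K IH; rewrite blocksS size_cat IH size_map size_iota mulSn addnC.
Qed.

(** Before the base word the wires named 0, 2, ..., 2n occupy the lower half
    in this order, and the wires named 2n+2, ..., 4n the upper half in reverse
    order, with the middle wire between them. *)
Definition wire_pos (c : int) : nat :=
  if even_int c then
    let j := `|(c %% (4 * n + 2)%:Z)%Z|%N./2 in if (j <= n)%N then j else (3 * n + 2 - j)%N
  else n.+1.

Definition base_wire (c : int) : coord := inord (wire_pos c).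

Lemma wire_pos_odd c : ~~ even_int c -> wire_pos c = n.+1.
Proof. by rewrite /wire_pos => /negbTE ->. Qed.

Lemma wire_pos_even (c k : int) (j : nat) : c = 2 * j%:Z + k * (4 * n + 2)%:Z ->
  (j <= n.*2)%N -> wire_pos c = if (j <= n)%N then j else (3 * n + 2 - j)%N.
Proof.
move=> -> hj; rewrite /wire_pos addrC modzMDl modz_small; last by lia.
rewrite (_ : even_int _ = true); last by rewrite /even_int; lia.
by rewrite (_ : (`|(2 * j%:Z)%R|)%N./2 = j) //; lia.
Qed.

Lemma even_wireP c : even_int c ->
  exists (k : int) (j : nat), c = 2 * j%:Z + k * (4 * n + 2)%:Z /\ (j <= n.*2)%N.
Proof.
move=> ec; have := divz_eq c (4 * n + 2)%:Z; set k := (c %/ _)%Z; set r := (c %% _)%Z => hc.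
have hr : 0 <= r < (4 * n + 2)%:Z by rewrite modz_ge0 ?ltz_pmod //; lia.
have er : even_int r.
  by move: ec; rewrite {1}hc /even_int /dvdz; rewrite -!/(dvdz _ _); lia.
by exists k, (`|r|%N./2); rewrite /even_int in er; split; lia.
Qed.

Lemma wire_pos_bound c : (wire_pos c < n.*2.+2)%N.
Proof.
case: (boolP (even_int c)) => [ec|/wire_pos_odd ->]; last by lia.
have [k [j [hc hj]]] := even_wireP ec; rewrite (wire_pos_even hc hj); case: ifP => h; lia.
Qed.

Lemma base_wire_same p q : (base_wire p == base_wire q) = same_wire p q.
Proof.
rewrite /base_wire inord_eq; try by have := wire_pos_bound p; have := wire_pos_bound q; lia.
case: (boolP (even_int p)) => ep; case: (boolP (even_int q)) => eq_.
- have [k [i [hp hi]]] := even_wireP ep; have [l [j [hq hj]]] := even_wireP eq_.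
  rewrite (wire_pos_even hp hi) (wire_pos_even hq hj).
  have -> : ((if (i <= n)%N then i else (3 * n + 2 - i)%N) ==
             (if (j <= n)%N then j else (3 * n + 2 - j)%N)) = (i == j).
    by case: ifP => h1; case: ifP => h2; lia.
  apply/eqP/idP => [E|/(same_wire_evenP _ _ ep) [t ht]].
    by apply/(same_wire_evenP _ _ ep); exists (k - l); rewrite hp hq E; ring.
  suff : l + t - k = 0.
    move=> E; have : 2 * i%:Z = 2 * j%:Z + (l + t - k) * (4 * n + 2)%:Z.
      by rewrite -[LHS](addrK (k * (4 * n + 2)%:Z)) -hp ht hq; ring.
    by rewrite E; lia.
  apply: (@small_multiple (4 * n + 2)%:Z _ (2 * i%:Z - 2 * j%:Z)); last by lia.
  have : 2 * i%:Z = p - k * (4 * n + 2)%:Z by rewrite hp; ring.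
  by move=> ->; rewrite ht hq; ring.
- rewrite (wire_pos_odd eq_) /same_wire ep (negbTE eq_) /=.
  have [k [i [hp hi]]] := even_wireP ep; rewrite (wire_pos_even hp hi).
  by case: ifP => h; lia.
- rewrite (wire_pos_odd ep) /same_wire (negbTE ep) eq_ /=.
  have [k [i [hp hi]]] := even_wireP eq_; rewrite (wire_pos_even hp hi).
  by case: ifP => h; lia.
by rewrite !wire_pos_odd // eqxx (same_wire_odd _ _ ep).
Qed.

Lemma wire_pos_onto l : (l <= n.*2.+1)%N -> exists c, wire_pos c = l.
Proof.
move=> hl; have [hn|hn|hn] := ltngtP l n.+1.
- exists (2 * l%:Z); rewrite (@wire_pos_even _ 0 l) ?mul0r ?addr0 //; last by lia.
  by case: ifP; lia.
- exists (2 * (3 * n + 2 - l)%N%:Z).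
  rewrite (@wire_pos_even _ 0 (3 * n + 2 - l)%N) ?mul0r ?addr0 //; last by lia.
  by case: ifP; lia.
by exists 1; rewrite wire_pos_odd.
Qed.

Lemma base_pos kap i : (kap <= n.*2)%N -> (0 < i <= n.+1)%N ->
  (wire_pos (block_label kap i).1 < wire_pos (block_label kap i).2)%N.
Proof.
move=> hk hi; rewrite /block_label /gap; case: ifP => ok /=.
  rewrite [X in (_ < X)%N](@wire_pos_even _ 0 (uphalf kap + n)%N); try by lia.
  case: (eqVneq i n.+1) => hin.
    by rewrite wire_pos_odd /even_int; [case: ifP|]; lia.
  case: (leqP n.+1 (uphalf kap + i)) => h.
    by rewrite (@wire_pos_even _ 0 (uphalf kap + i - n.+1)%N); [do 2 case: ifP|..]; lia.
  by rewrite (@wire_pos_even _ (-1) (uphalf kap + i + n)%N); [do 2 case: ifP|..]; lia.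
rewrite [X in (X < _)%N](@wire_pos_even _ 0 kap./2); try by lia.
case: (eqVneq i n.+1) => hin.
  by rewrite [X in (_ < X)%N]wire_pos_odd /even_int; [case: ifP|]; lia.
by rewrite (@wire_pos_even _ 0 (kap./2 + i)%N); [do 2 case: ifP|..]; lia.
Qed.

(** An odd block is described upside down: l' is the distance of the height l
    from the top. *)
Definition wire_before (kap l : nat) : int :=
  if odd kap then
    let l' := (n.*2.+1 - l)%N in
    if (l' <= n)%N then kap%:Z - n.*2.+1%:Z + l'.*2%:Z
    else if l' == n.+1 then kap%:Z else kap%:Z + (4 * n + 3)%:Z - l'.*2%:Z
  else if (l <= n)%N then kap%:Z + l.*2%:Z
    else if l == n.+1 then kap%:Z + n.*2.+1%:Z else kap%:Z + n.*2.+2%:Z - l.*2%:Z.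

(** As wire_before, after j letters of the block: the wire which crosses the
    block has moved j steps, and those it has passed are shifted by one. *)
Definition wire_at (kap j l : nat) : int :=
  if odd kap then
    let l' := (n.*2.+1 - l)%N in
    if (l' < j)%N then wire_before kap l.-1
    else if l' == j then kap%:Z + n.*2.+1%:Z else wire_before kap l
  else if (l < j)%N then wire_before kap l.+1
    else if l == j then kap%:Z else wire_before kap l.

Definition block_letter (kap i : nat) : nat := if odd kap then (n.*2.+2 - i)%N else i.

Lemma wire_at_lower kap j : (j <= n)%N ->
  wire_at kap j (block_letter kap j.+1).-1 = (block_label kap j.+1).1.
Proof.
move=> hj; rewrite /wire_at /block_letter /block_label /gap /wire_before.
by case: (odd kap) => /=; do !case: ifP => ? /=; lia.
Qed.

Lemma wire_at_upper kap j : (j <= n)%N ->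
  wire_at kap j (block_letter kap j.+1) = (block_label kap j.+1).2.
Proof.
move=> hj; rewrite /wire_at /block_letter /block_label /gap /wire_before.
by case: (odd kap) => /=; do !case: ifP => ? /=; lia.
Qed.

Lemma wire_at_step kap j l : (j <= n)%N -> (l <= n.*2.+1)%N ->
  let i := block_letter kap j.+1 in
  wire_at kap j.+1 l =
  wire_at kap j (if l == i.-1 then i else if l == i then i.-1 else l).
Proof.
move=> hj hl; rewrite /wire_at /block_letter; case: (odd kap) => /=.
  have [e1|n1] := eqVneq l (n.*2.+2 - j.+1).-1; [|have [e2|n2] := eqVneq l (n.*2.+2 - j.+1)%N];
  do !case: ifP => ? /=; try (by exfalso; lia); by [|congr wire_before; lia].
have [e1|n1] := eqVneq l j; [|have [e2|n2] := eqVneq l j.+1];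
do !case: ifP => ? /=; try (by exfalso; lia); by [|congr wire_before; lia].
Qed.

(** The wire that turns at the top, and the middle wire, are named differently
    by consecutive blocks. *)
Lemma wire_at_next kap l : (l <= n.*2.+1)%N ->
  same_wire (wire_at kap n.+1 l) (wire_at kap.+1 0 l).
Proof.
move=> hl.
have [E|[E|[o1 o2]]] : wire_at kap n.+1 l = wire_at kap.+1 0 l \/
    wire_at kap n.+1 l = wire_at kap.+1 0 l - (4 * n + 2)%:Z \/
    ~~ even_int (wire_at kap n.+1 l) /\ ~~ even_int (wire_at kap.+1 0 l).
- rewrite /wire_at /wire_before /even_int /=.
  by case: (boolP (odd kap)) => ok /=; do !case: ifP => ? /=; lia.
- by rewrite E same_wire_refl.
- by rewrite E same_wire_sym same_wire_period same_wire_refl.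
by rewrite same_wire_odd.
Qed.

(** The induction carries the positions of all wires, not only of the two that
    meet, because later letters depend on them. *)
Lemma blocks_rooted K : 
  (forall l, (l <= n.*2.+1)%N -> weyl (blocks K) (inord l) = base_wire (wire_at K 0 l)) /\
  rooted base_wire 1%g (blocks K).
Proof.
elim: K => [|K [st R]].
  split=> // l hl; rewrite /weyl_elt big_nil perm1.
  rewrite /base_wire /wire_at /wire_before /=; congr inord; apply/esym.
  case: (l =P 0%N) => [->|l0]; first by rewrite (@wire_pos_even _ 0 0%N).
  case: ifP => h1.
    by rewrite (@wire_pos_even _ 0 l) ?h1 //; lia.
  case: ifP => h2; first by rewrite wire_pos_odd /even_int; lia.
  by rewrite (@wire_pos_even _ (-1) (3 * n + 2 - l)%N); [case: ifP|..]; lia.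
suff H j : (j <= n.+1)%N ->
    (forall l, (l <= n.*2.+1)%N ->
      weyl (blocks K ++ part_block K j) (inord l) = base_wire (wire_at K j l)) /\
    rooted base_wire 1%g (blocks K ++ part_block K j).
  have [st' R'] := H n.+1 (leqnn _); rewrite blocksS; split=> // l hl.
  by rewrite st' //; apply/eqP; rewrite base_wire_same wire_at_next.
elim: j => [_|j IH hj]; first by rewrite cats0.
have {IH} [|st' R'] := IH; first exact: ltnW.
rewrite part_blockS -rcons_cat -cats1.
set t := blocks K ++ part_block K j in st' R' *.
have rE : residue (block_label K j.+1) = block_letter K j.+1.
  by rewrite residue_block_label.
have bi : (0 < block_letter K j.+1 <= n.*2.+1)%N by rewrite /block_letter; case: ifP; lia.
split.
  move=> l hl; rewrite map_cat weyl_elt_cat /= weyl_elt1 rE permM wire_at_step //.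
  set i := block_letter K j.+1 in bi *.
  case: (eqVneq l i.-1) => [->|h1]; first by rewrite /simple_refl tpermL st'; [|lia].
  case: (eqVneq l i) => [->|h2]; first by rewrite /simple_refl tpermR st'; [|lia].
  by rewrite simple_refl_far // st'.
rewrite rooted_cat; split=> //=; rewrite mulg1 rE !st'; try by lia.
by rewrite wire_at_lower // wire_at_upper.
Qed.

Lemma base_diagram : diagram (blocks n.*2.+1) base_cut base_wire.
Proof.
have [st R] := blocks_rooted n.*2.+1; split=> //.
- exact: base_window.
- exact: base_wire_same.
- move=> i; have [|c hc] := @wire_pos_onto i; first by rewrite -ltnS ltn_ord.
  by exists c; rewrite /base_wire hc inord_val.
- move=> z /mem_blocks [kap [i [hk hi ->]]].
  by rewrite /base_wire !inordK ?wire_pos_bound // base_pos.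
- apply/permP => i; rewrite -(inord_val i); have hi : (i <= n.*2.+1)%N by rewrite -ltnS ltn_ord.
  rewrite st // longest_eltE // /base_wire /wire_at /wire_before /= odd_double /=; congr inord.
  case: ifP => h2.
    rewrite (@wire_pos_even _ 1 0%N) //=; lia.
  case: ifP => h3.
    by rewrite (@wire_pos_even _ 0 (n.*2.+1 - i)%N) ?h3 //; lia.
  case: ifP => h4; first by rewrite wire_pos_odd /even_int; lia.
  by rewrite (@wire_pos_even _ 0 (3 * n + 2 - (n.*2.+1 - i))%N); [case: ifP|..]; lia.
exact: size_blocks.
Qed.

(** A reflection functor acts on a representative of the class, and so can be
    applied to a suitable linear extension of the window. *)
Lemma twisted_diagram w : twisted_adapted n w ->
  exists s C sigma, w = map residue s /\ @diagram n s C sigma.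
Proof.
elim => {w} [w|i w w' _ _ [s [C [sigma [-> D]]]]|i w w' _ _ [s [C [sigma [-> D]]]]].
- rewrite -blocks_base => /(diagram_comm base_diagram) [s -> D].
  by exists s, base_cut, base_wire.
- case=> [[v [c c']]|[_ /(diagram_comm D) [s' -> D']]]; last by exists s', C, sigma.
  have [[|x t] // [Ei Ev] D1] := diagram_comm D c; subst i v.
  have [C' [sigma' D2]] := diagram_first D1.
  have vx : valid x by apply: (window_valid (diagram_window D1)); rewrite mem_head.
  rewrite -residue_next // -map_rcons in c'.
  by have [s' -> D3] := diagram_comm D2 c'; exists s', C', sigma'.
case=> [[v [c c']]|[_ /(diagram_comm D) [s' -> D']]]; last by exists s', C, sigma.
have [s1 E D1] := diagram_comm D c; case/lastP: s1 E D1 => [|t x]; first by case: (v).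
rewrite map_rcons => /rcons_inj [Ev Ei] D1; subst i v.
have [C' [sigma' D2]] := diagram_last D1.
have vx : valid x by apply: (window_valid (diagram_window D1)); rewrite mem_rcons mem_head.
have rp : star n (residue x) = residue (prev x).
  by rewrite -{1}(prevK n x) residue_next ?valid_prev // /star;
     have := residue_bound (n := n) (z := prev x); rewrite valid_prev vx => /(_ isT); lia.
rewrite rp in c'.
by have [s' -> D3] := diagram_comm (s := prev x :: t) D2 c'; exists s', C', sigma'.
Qed.
End Base.

Theorem proposition8p11 (n : nat) (hn : (1 <= n)%N) (k l : nat)
    (hk : (1 <= k <= n.+1)%N) (hl : (1 <= l <= n.+1)%N)
    (i0 i0' : seq nat)
    (h0 : twisted_adapted n i0) (h0' : twisted_adapted n i0')
    (Om Om' : posroot n -> (nat * rat)%type)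
    (hOm : is_coordinate i0 Om) (hOm' : is_coordinate i0' Om') :
  folded_dist_poly i0 Om k l = folded_dist_poly i0' Om' k l.
Proof.
have [s [C [sigma [E D]]]] := twisted_diagram h0.
have [s' [C' [sigma' [E' D']]]] := twisted_diagram h0'; subst i0 i0'.
apply: folded_dist_poly_charts (diagram_chart D) _ (diagram_chart D') _.
  exact: diagram_coordinates hn D hOm.
exact: diagram_coordinates hn D' hOm'.
Qed.
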